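(* Let $p=p(s)=\omega\left(\frac{\sqrt s}{2^{2s}}\right)$. Then almost surely $$q^*(G_p(4s,2s,s))\to 0,\quad s\to\infty.$$
   Context: For integers $n,r,s$, the Johnson graph $G(n,r,s)$ has as vertices all vectors $v\in\{0,1\}^n$ with exactly $r$ ones; two vertices are joined by an edge if and only if their inner product equals $s$. For $p\in[0,1]$, $G_p(n,r,s)$ is the random graph obtained from $G(n,r,s)$ by removing every edge with probability $1-p$ independently of all other edges. The random graphs of the sequence are regarded as defined on a common probability space. Modularity: for a graph $G$ with $e(G)$ edges and a partition $\mathcal{A}$ of its vertex set, $q(\mathcal{A})=\sum_{A\in\mathcal{A}}\frac{e(A)}{e(G)}-\sum_{A\in\mathcal{A}}\frac{(\sum_{v\in A}\deg(v))^2}{4e(G)^2}$, where $e(A)$ is the number of edges of $G$ with both endpoints in $A$. The modularity of $G$ is $q^*(G)=\max_{\mathcal{A}}q(\mathcal{A})$, over all partitions of the vertex set. $f=\omega(g)$ means $f(s)/g(s)\to\infty$ as $s\to\infty$. *)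

(* Defs.v *)
From mathcomp Require Import all_boot all_order all_algebra.
From mathcomp Require Import all_classical all_reals all_analysis.
Set Implicit Arguments.
Unset Strict Implicit.
Unset Printing Implicit Defensive.
Import Order.TTheory GRing.Theory Num.Theory.
Import numFieldNormedType.Exports.
Local Open Scope classical_set_scope.
Local Open Scope ring_scope.

(* A graph on the finite vertex type V is given by its set of edges
   E : {set {set V}}, an edge being the set of its two endpoints. *)

Section Modularity.
Variables (R : realType) (V : finType).
Implicit Types (E : {set {set V}}) (A : {set V}) (Q : {set {set V}}).

Definition edges_within E A : nat := #|[set e in E | e \subset A]|.

Definition degree E (v : V) : nat := #|[set e in E | v \in e]|.

(* For an edgeless graph both quotients are x / 0 = 0, so the score is 0. *)
Definition modularity_score E Q : R :=
  \sum_(A in Q) (edges_within E A)%:R / #|E|%:R -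
  \sum_(A in Q) (\sum_(v in A) degree E v)%:R ^+ 2 / (4 * #|E|%:R ^+ 2).

Definition singleton_partition : {set {set V}} := [set [set v] | v : V]%SET.

(* [singleton_partition] is itself a partition of the vertex set, so taking its
   score as the default value of the iterated maximum is harmless. *)
Definition modularity E : R :=
  \big[Num.max/modularity_score E singleton_partition]_(Q : {set {set V}} |
    finset.partition Q [set: V]%SET) modularity_score E Q.

End Modularity.

Section Johnson.
Variables n r s : nat.

Definition johnson_vertex : finType :=
  {v : {ffun 'I_n -> bool} | (\sum_(i < n) v i == r)%N}.

Definition inner_product (v w : johnson_vertex) : nat :=
  (\sum_(i < n) val v i * val w i)%N.

(* [v != w] only matters for r = s, where it excludes loops. *)
Definition johnson_graph : {set {set johnson_vertex}} :=
  [set [set u.1; u.2] | u : johnson_vertex * johnson_vertex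
     & (u.1 != u.2) && (inner_product u.1 u.2 == s)]%SET.

End Johnson.

Section RandomGraph.
Variables (R : realType) (d : measure_display) (T : measurableType d).
Variable P : probability T R.

Definition independent_events (I : finType) (J : {set I}) (X : I -> set T) :=
  forall F : {set I}, F \subset J ->
    P (\bigcap_(i in [set` F]) X i) = (\prod_(i in F) P (X i))%E.

Definition removal_event (V : finType) (G : T -> {set {set V}}) (e : {set V}) :
  set T := [set w | e \notin G w].

(* G is the random graph obtained from the graph E by removing every edge with
   probability 1 - p, independently of all other edges. *)
Definition random_subgraph (V : finType) (E : {set {set V}}) (p : R)
    (G : T -> {set {set V}}) : Prop :=
  [/\ forall w, G w \subset E,
      forall e, e \in E -> measurable (removal_event G e),
      forall e, e \in E -> P (removal_event G e) = (1 - p)%:E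
    & independent_events E (removal_event G)].

End RandomGraph.

Definition little_omega (R : realType) (f g : nat -> R) : Prop :=
  (fun s => f s / g s) @ \oo --> +oo.

(* Main.v *)
(** Write N for the number of vertices and D for the degree of the Johnson
    graph with n = 4s, r = 2s.  Let K be the adjacency matrix minus D/N times
    the all-ones matrix.  If K has a non-constant eigenfunction with
    eigenvalue l, then its orbit under permutations of the coordinates spans
    at least s - 1 pairwise orthogonal ones, so l^2 (s - 1) <= tr K^2 <= N D.
    Since N/D = O(sqrt s), every positive eigenvalue is O(D s^(-1/4)), and for
    every partition the fraction of edges inside its parts exceeds the sum of
    the squared relative sizes of the parts by at most O(s^(-1/4)).

    For p >= sqrt s / 4^s the expected degree p D is at least of order
    4^s / s, which dwarfs log N = O(s).  Chernoff bounds with relative error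
    1/s therefore survive a union bound over all degrees and over all of the at
    most N^N partitions, with failure probability O(e^(-s)).  Outside these
    events the modularity is O(s^(-1/4)), and Borel-Cantelli concludes. *)
Require Import Defs.
From mathcomp Require Import all_boot all_order all_algebra.
From mathcomp Require Import all_classical all_reals all_analysis.
From mathcomp Require Import fingroup perm ring lra zify.
Set Implicit Arguments.
Unset Strict Implicit.
Unset Printing Implicit Defensive.
Import Order.TTheory GRing.Theory Num.Theory.
Import numFieldNormedType.Exports.
Local Open Scope classical_set_scope.
Local Open Scope ring_scope.

(** * The largest eigenvalue of a symmetric kernel *)

(** The quadratic form is continuous and the unit sphere compact, so a maximum is attained there;
    homogeneity of degree two carries the bound over to every [x]. Functions on [V] are read as row
    vectors to have the topology at hand. *)
Lemma rayleigh_max (R : realType) (V : finType) (K : V -> V -> R) :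
  (0 < #|V|)%N ->
  exists f : V -> R, \sum_v f v ^+ 2 = 1 /\
    forall x : V -> R, \sum_v \sum_w K v w * x v * x w <=
      (\sum_v \sum_w K v w * f v * f w) * \sum_v x v ^+ 2.
Proof.
move=> V0.
pose n := #|V|.
pose fn (r : 'rV[R]_n) : V -> R := fun v => r ord0 (enum_rank v).
pose q (x : V -> R) := \sum_v \sum_w K v w * x v * x w.
pose sq (x : V -> R) := \sum_v x v ^+ 2.
pose A := [set r : 'rV[R]_n | sq (fn r) = 1].
have cfn v : continuous (fun r : 'rV[R]_n => fn r v).
  by move=> r; exact: coord_continuous.
have csum (g : V -> 'rV[R]_n -> R) :
    (forall v, continuous (g v)) -> continuous (fun r => \sum_v g v r).
  by move=> cg; apply: continuous_big => [|v _]; [exact: add_continuous|exact: cg].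
have cq : continuous (fun r : 'rV[R]_n => q (fn r)).
  apply: (csum (fun v r => \sum_w K v w * fn r v * fn r w)) => v.
  apply: (csum (fun w r => K v w * fn r v * fn r w)) => w r; rewrite /continuous_at /=.
  exact: (cvgM (cvgM (cvg_cst _) (cfn v r)) (cfn w r)).
have csq : continuous (fun r : 'rV[R]_n => sq (fn r)).
  apply: (csum (fun v r => fn r v ^+ 2)) => v r.
  by under eq_fun do rewrite expr2; exact: (cvgM (cfn v r) (cfn v r)).
have cA : compact A.
  apply: bounded_closed_compact.
    exists 1; split=> // M M1 r /= rA.
    rewrite [leLHS]/Num.norm /= mx_normrE; apply: bigmax_le => [|[i j] _ /=].
      by rewrite (le_trans _ (ltW M1)).
    rewrite (le_trans _ (ltW M1))// -(@ler_sqr _ _ 1) ?nnegrE//.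
    rewrite real_normK ?num_real//.
    rewrite expr1n -rA /sq (bigD1 (enum_val j))//= /fn enum_valK (ord1 i) lerDl sumr_ge0// => v _.
    exact: sqr_ge0.
  have -> : A = (fun r => sq (fn r)) @^-1` [set 1] by [].
  by apply: closed_comp => // r _; exact: csq.
have fnK (x : V -> R) : fn (\row_i x (enum_val i)) = x.
  by apply/funext => v; rewrite /fn mxE enum_rankK.
have sqZ a (x : V -> R) : sq (fun v => a * x v) = a ^+ 2 * sq x.
  by rewrite /sq mulr_sumr; apply: eq_bigr => v _; rewrite exprMn.
have qZ a (x : V -> R) : q (fun v => a * x v) = a ^+ 2 * q x.
  rewrite /q mulr_sumr; apply: eq_bigr => v _; rewrite mulr_sumr.
  by apply: eq_bigr => w _; ring.
have sq_ge0 x : 0 <= sq x by apply: sumr_ge0 => v _; exact: sqr_ge0.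
have sq_eq0 x : sq x = 0 -> forall v, x v = 0.
  move=> /psumr_eq0P x0 v; apply/eqP; rewrite -sqrf_eq0; apply/eqP/x0 => // w _.
  exact: sqr_ge0.
have [v0 _] : exists v0 : V, true by move/card_gt0P: V0 => [v _]; exists v.
have A0 : A !=set0.
  exists (\row_i (enum_val i == v0)%:R).
  rewrite /A /= /sq (bigD1 v0)//= big1 => [|v vv0].
    by rewrite /fn mxE enum_rankK eqxx expr1n addr0.
  by rewrite /fn mxE enum_rankK (negbTE vv0) expr0n.
have [c /set_mem cA1 cmax] :=
  compact_EVT_max A0 cA (continuous_subspaceT cq).
exists (fn c); split => // x.
rewrite -[leLHS]/(q x) -[X in X * _]/(q (fn c)) -[X in _ * X]/(sq x).
have [x0|x0] := eqVneq (sq x) 0.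
  rewrite x0 mulr0 /q big1// => v _; rewrite big1// => w _.
  by rewrite (sq_eq0 _ x0 v) mulr0 mul0r.
have sx : 0 < sq x by rewrite lt_neqAle eq_sym x0 sq_ge0.
pose a := (Num.sqrt (sq x))^-1.
have a2 : a ^+ 2 = (sq x)^-1 by rewrite exprVn sqr_sqrtr.
have xA : \row_i (a * x (enum_val i)) \in A.
  by apply/mem_set; rewrite /A /= (fnK (fun v => a * x v)) sqZ a2 mulVf.
have := cmax _ xA.
by rewrite (fnK (fun v => a * x v)) qZ a2 mulrC ler_pdivrMr.
Qed.

(** A maximiser of the Rayleigh quotient of a symmetric kernel is a critical point, hence an
    eigenfunction, and the maximum is its eigenvalue. *)
Lemma max_eigenvector (R : realType) (V : finType) (K : V -> V -> R) :
  (0 < #|V|)%N -> (forall v w, K v w = K w v) ->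
  exists (l : R) (f : V -> R), [/\ exists v, f v != 0,
    forall v, \sum_w K v w * f w = l * f v
  & forall x : V -> R,
      \sum_v \sum_w K v w * x v * x w <= l * \sum_v x v ^+ 2].
Proof.
move=> V0 Ksym; have [f [f1]] := rayleigh_max K V0.
have [l lE] : exists l, l = \sum_v \sum_w K v w * f v * f w by eexists.
rewrite -lE => ub.
pose q (x : V -> R) := \sum_v \sum_w K v w * x v * x w.
pose sq (x : V -> R) := \sum_v x v ^+ 2.
have {}ub x : q x <= l * sq x := ub x.
exists l, f; split => //.
  apply: contrapT => /forallNP f0.
  have /eqP := f1; rewrite big1 ?(eq_sym 0) ?oner_eq0// => v _.
  by have /negP := f0 v; rewrite negbK => /eqP ->; rewrite expr0n.
move=> v; apply/eqP; rewrite eq_sym -subr_eq0; apply/eqP.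
pose y u := (u == v)%:R : R.
pose b := l * f v - \sum_w K v w * f w.
have sumy (g : V -> R) : \sum_w g w * y w = g v.
  rewrite (bigD1 v)//= big1 ?addr0 => [|u uv]; first by rewrite /y eqxx mulr1.
  by rewrite /y (negbTE uv) mulr0.
(* [f] maximises the Rayleigh quotient, so the derivative in the direction [y]
   vanishes. *)
have quad t : 0 <= 2 * t * b + t ^+ 2 * (l - K v v).
  have := ub (fun u => f u + t * y u); rewrite -subr_ge0.
  have -> : sq (fun u => f u + t * y u) = sq f + 2 * t * f v + t ^+ 2.
    rewrite /sq.
    transitivity (\sum_u (f u ^+ 2 + (2 * t * f u + t ^+ 2) * y u)).
      by apply: eq_bigr => u _ /=; rewrite /y; case: (u == v) => /=; ring.
    by rewrite big_split /= sumy addrA.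
  have -> : q (fun u => f u + t * y u) =
      l + 2 * t * \sum_w K v w * f w + t ^+ 2 * K v v.
    transitivity (q f + t * (\sum_u (\sum_w K u w * f w) * y u)
        + t * (\sum_u (\sum_w (K u w * f u) * y w))
        + t ^+ 2 * (\sum_u (\sum_w K u w * y w) * y u)).
      rewrite /q !mulr_sumr -!big_split /=; apply: eq_bigr => u _.
      rewrite !mulr_suml !mulr_sumr -!big_split /=; apply: eq_bigr => w _; ring.
    rewrite !sumy.
    have -> : \sum_u \sum_w K u w * f u * y w = \sum_w K v w * f w.
      by apply: eq_bigr => u _; rewrite sumy Ksym.
    by rewrite -[q f]lE; ring.
  rewrite [sq f]f1 /b; lra.
have Kle : 0 <= l - K v v.
  have := ub y; rewrite subr_ge0 /q /sq.
  rewrite (eq_bigr _ (fun u _ => sumy (fun w => K u w * y u))) sumy.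
  by rewrite (eq_bigr _ (fun u _ => expr2 (y u))) sumy /y eqxx mulr1.
rewrite -/b; apply/eqP; apply: contraT => b0.
(* A nonzero slope [b] would make the quadratic negative at this point; the [+ 1] keeps the
   denominator positive even if [l = K v v]. *)
have := quad (- b / (l - K v v + 1)).
set z := l - K v v in Kle *.
have -> : 2 * (- b / (z + 1)) * b + (- b / (z + 1)) ^+ 2 * z =
  - (b ^+ 2 * (z + 2) / (z + 1) ^+ 2) by field; lra.
rewrite oppr_ge0 leNgt divr_gt0//; last by rewrite exprn_gt0//; lra.
by rewrite mulr_gt0 ?exprn_even_gt0//; lra.
Qed.

(** * Bessel's inequality and eigenvalue multiplicity *)

(** Here [s] is [c] times the orthogonal projection of [k] onto the span of the [h i]; expanding the
    squared norm of [c * k - s] gives the inequality. *)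
Lemma bessel (R : realType) (V I : finType) (h : I -> V -> R) (c : R) (k : V -> R) :
  0 < c -> (forall i, \sum_v h i v ^+ 2 = c) ->
  (forall i j, i != j -> \sum_v h i v * h j v = 0) ->
  \sum_i (\sum_v k v * h i v) ^+ 2 <= c * \sum_v k v ^+ 2.
Proof.
move=> c0 hc h0.
pose a i := \sum_v k v * h i v; pose s v := \sum_i a i * h i v.
have ks : \sum_v k v * s v = \sum_i a i ^+ 2.
  under eq_bigr do rewrite mulr_sumr.
  rewrite exchange_big /=; apply: eq_bigr => i _.
  rewrite expr2 {3}/a mulr_sumr; apply: eq_bigr => v _; ring.
have hs i : \sum_v h i v * s v = c * a i.
  under eq_bigr do rewrite mulr_sumr.
  rewrite exchange_big /= (bigD1 i)//= [X in _ + X]big1 ?addr0 => [|j ji].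
    rewrite -(hc i) mulr_suml; apply: eq_bigr => v _; ring.
  transitivity (a j * \sum_v h i v * h j v).
    by rewrite mulr_sumr; apply: eq_bigr => v _; ring.
  by rewrite h0 ?mulr0 1?eq_sym.
have ss : \sum_v s v ^+ 2 = c * \sum_i a i ^+ 2.
  transitivity (\sum_v \sum_i a i * (h i v * s v)).
    apply: eq_bigr => v _; rewrite expr2 {1}/s mulr_suml.
    by apply: eq_bigr => i _; ring.
  rewrite exchange_big mulr_sumr /=; apply: eq_bigr => i _.
  by rewrite -mulr_sumr hs; ring.
have : 0 <= \sum_v (c * k v - s v) ^+ 2 by apply: sumr_ge0 => v _; exact: sqr_ge0.
have -> : \sum_v (c * k v - s v) ^+ 2 =
    c ^+ 2 * (\sum_v k v ^+ 2) - 2 * c * (\sum_v k v * s v) + \sum_v s v ^+ 2.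
  rewrite !mulr_sumr -sumrB -big_split /=; apply: eq_bigr => v _; ring.
rewrite ks ss => H; rewrite -(ler_pM2l c0); lra.
Qed.

(** Bessel's inequality is applied to each row of [K], whose coefficient against [h i] is
    [l * h i v]; summing over the rows bounds the squared Frobenius norm from below. *)
Lemma eigenvalue_multiplicity_bound (R : realType) (V I : finType)
    (K : V -> V -> R) (l c : R) (h : I -> V -> R) :
  0 < c -> (forall i, \sum_v h i v ^+ 2 = c) ->
  (forall i j, i != j -> \sum_v h i v * h j v = 0) ->
  (forall i v, \sum_w K v w * h i w = l * h i v) ->
  l ^+ 2 * #|I|%:R <= \sum_v \sum_w K v w ^+ 2.
Proof.
move=> c0 hc h0 hK; rewrite -(ler_pM2l c0) mulr_sumr.
have -> : c * (l ^+ 2 * #|I|%:R) = \sum_v \sum_i (\sum_w K v w * h i w) ^+ 2.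
  rewrite exchange_big /= (eq_bigr (fun=> c * l ^+ 2)) => [|i _].
    by rewrite sumr_const -[RHS]mulr_natr mulrA.
  by rewrite -(hc i) mulr_suml; apply: eq_bigr => v _; rewrite hK; ring.
by apply: ler_sum => v _; exact: bessel.
Qed.

(** * Coordinate permutations of Johnson vertices *)

Lemma perm_vertex_subproof n r (p : {perm 'I_n}) (v : johnson_vertex n r) :
  (\sum_(i < n) [ffun i => val v (p i)] i == r)%N.
Proof.
apply/eqP; transitivity (\sum_(i < n) val v i)%N; last exact/eqP/(valP v).
rewrite [RHS](reindex_inj (@perm_inj _ p)) /=.
by apply: eq_bigr => i _; rewrite ffunE.
Qed.

(** Products of permutations apply their left factor first, so composing with [p] itself, not its
    inverse, makes this a left action. *)
Definition perm_vertex n r (p : {perm 'I_n}) (v : johnson_vertex n r) :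
  johnson_vertex n r := Sub [ffun i => val v (p i)] (perm_vertex_subproof p v).

Lemma perm_vertexE n r (p : {perm 'I_n}) (v : johnson_vertex n r) i :
  val (perm_vertex p v) i = val v (p i).
Proof. by rewrite ffunE. Qed.

Lemma vertex_eqP n r (v w : johnson_vertex n r) :
  (forall i, val v i = val w i) -> v = w.
Proof. by move=> vw; apply/val_inj/ffunP. Qed.

Lemma perm_vertexM n r (p q : {perm 'I_n}) (v : johnson_vertex n r) :
  perm_vertex (p * q)%g v = perm_vertex p (perm_vertex q v).
Proof. by apply: vertex_eqP => i; rewrite !perm_vertexE permM. Qed.

Lemma perm_vertex1 n r (v : johnson_vertex n r) : perm_vertex 1%g v = v.
Proof. by apply: vertex_eqP => i; rewrite perm_vertexE perm1. Qed.

Lemma perm_vertex_inj n r (p : {perm 'I_n}) :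
  injective (@perm_vertex n r p).
Proof.
by apply: (can_inj (g := perm_vertex p^-1%g)) => v;
  rewrite -perm_vertexM mulVg perm_vertex1.
Qed.

Lemma inner_product_perm n r (p : {perm 'I_n}) (v w : johnson_vertex n r) :
  inner_product (perm_vertex p v) (perm_vertex p w) = inner_product v w.
Proof.
rewrite /inner_product [RHS](reindex_inj (@perm_inj _ p)) /=.
by apply: eq_bigr => i _; rewrite !perm_vertexE.
Qed.

Definition vsupp n r (v : johnson_vertex n r) : {set 'I_n} := [set i | val v i]%SET.

Lemma card_vsupp n r (v : johnson_vertex n r) : #|vsupp v| = r.
Proof.
transitivity (\sum_(i < n) val v i)%N; last exact/eqP/(valP v).
rewrite -sum1_card big_mkcond /=.
by apply: eq_bigr => i _; rewrite inE; case: (val v i).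
Qed.

Lemma vsupp_inj n r : injective (@vsupp n r).
Proof.
by move=> v w /setP vw; apply: vertex_eqP => i; have := vw i; rewrite !inE.
Qed.

(** Exchanging a one of [v] outside the support of [w] with a zero of [v] inside it brings [v]
    closer to [w]. Both supports have size [r], so such a pair exists until they coincide. *)
Lemma tperm_invariant_const n r (T : Type) (f : johnson_vertex n r -> T) :
  (forall (v : johnson_vertex n r) i j, val v i -> ~~ val v j ->
    f (perm_vertex (tperm i j) v) = f v) ->
  forall v w, f v = f w.
Proof.
move=> finv v w.
have [d] := ubnP #|vsupp v :\: vsupp w|%SET.
elim: d v => // d IH v; rewrite ltnS => vw.
have [vw0|] := boolP (vsupp v \subset vsupp w).
  congr f; apply: vsupp_inj; apply/eqP.
  by rewrite eqEcard vw0 !card_vsupp leqnn.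
move=> nvw; have := nvw; rewrite -finset.setD_eq0 => /set0Pn[i]; rewrite !inE => /andP[wi vi].
have : ~~ (vsupp w \subset vsupp v).
  apply: contra nvw => wv.
  suff -> : vsupp w = vsupp v by [].
  by apply/eqP; rewrite eqEcard wv !card_vsupp leqnn.
rewrite -finset.setD_eq0 => /set0Pn[j]; rewrite !inE => /andP[vj wj].
rewrite -(finv v i j vi vj); apply: IH; apply: leq_trans vw.
apply/proper_card/properP; split; last first.
  by exists i; rewrite !inE ?wi ?vi// perm_vertexE tpermL (negbTE vj) andbF.
apply/fintype.subsetP => k; rewrite !inE perm_vertexE => /andP[wk].
by case: tpermP => [ki|kj|_ _]; [rewrite (negbTE vj)|rewrite kj wj in wk|rewrite wk].
Qed.

Lemma johnson_eigenvalue_bound (R : realType) n r m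
    (K : johnson_vertex n r -> johnson_vertex n r -> R) (l : R)
    (f : johnson_vertex n r -> R) :
  (2 * m < r)%N ->
  (forall p v w, K (perm_vertex p v) (perm_vertex p w) = K v w) ->
  (forall v, \sum_w K v w * f w = l * f v) ->
  (exists v w, f v <> f w) ->
  l ^+ 2 * m%:R <= \sum_v \sum_w K v w ^+ 2.
Proof.
move=> mr Kinv fK [v1 [w1 fvw]].
have eigen_perm p (g : johnson_vertex n r -> R) :
    (forall v, \sum_w K v w * g w = l * g v) ->
    forall v, \sum_w K v w * g (perm_vertex p w) = l * g (perm_vertex p v).
  move=> gK v; rewrite -gK [RHS](reindex_inj (@perm_vertex_inj _ _ p)) /=.
  by apply: eq_bigr => w _; rewrite Kinv.
have [v0 [i [j [vi vj fv0]]]] : exists (v : johnson_vertex n r) i j, [/\ val v i, ~~ val v j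
    & f (perm_vertex (tperm i j) v) <> f v].
  apply: contrapT => nex; apply/fvw/(@tperm_invariant_const n r R) => v i j vi vj.
  by apply: contrapT => fv; apply: nex; exists v, i, j.
(* [g] is antisymmetric under [t].  Averaging it over the permutations that fix
   [i], [j] and [v0] gives [h], still antisymmetric under [t] and nonzero at
   [v0], and symmetric under exchanging two further ones of [v0].  Moving the
   antisymmetry from the pair [i, j] to disjoint pairs [k b, k' b] of ones of
   [v0] gives the orthogonal functions [hh b]. *)
pose t := tperm i j.
pose g u := f u - f (perm_vertex t u).
have gK v : \sum_w K v w * g w = l * g v.
  rewrite /g mulrBr -fK -(eigen_perm t f fK) -sumrB.
  by apply: eq_bigr => w _; rewrite mulrBr.
have gt u : g (perm_vertex t u) = - g u.
  by rewrite /g -perm_vertexM tperm2 perm_vertex1 opprB.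
pose H := [pred p : {perm 'I_n} | [&& p i == i, p j == j & perm_vertex p v0 == v0]].
pose h u := \sum_(p | H p) g (perm_vertex p u).
have hK v : \sum_w K v w * h w = l * h v.
  rewrite /h mulr_sumr.
  under eq_bigr do rewrite mulr_sumr.
  by rewrite exchange_big; apply: eq_bigr => p _; exact: eigen_perm.
(* Every permutation in [H] fixes [v0], so the sum is a positive multiple of [g v0]. *)
have hv0 : h v0 != 0.
  rewrite /h (eq_bigr (fun=> g v0)) => [|p /and3P[_ _ /eqP ->]//].
  rewrite sumr_const -mulr_natr mulf_neq0//.
    by rewrite /g subr_eq0 eq_sym; apply/eqP.
  rewrite pnatr_eq0 -lt0n; apply/card_gt0P; exists 1%g.
  by rewrite unfold_in /= !perm1 perm_vertex1 !eqxx.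
(* Permutations fixing [i] and [j] commute with [t], so the antisymmetry survives the averaging. *)
have ht u : h (perm_vertex t u) = - h u.
  rewrite /h -sumrN; apply: eq_bigr => p /and3P[/eqP pi /eqP pj _].
  rewrite -gt -!perm_vertexM; congr (g (perm_vertex _ _)).
  by rewrite [RHS]conjgC tpermJ pi pj.
have hH q u : H q -> h (perm_vertex q u) = h u.
  move=> /and3P[/eqP qi /eqP qj /eqP qv].
  rewrite /h [RHS](reindex_inj (mulIg q)) /=.
  apply: eq_big => [p|p _]; last by rewrite perm_vertexM.
  by rewrite /H /= permM permM perm_vertexM qv -(inj_eq (@perm_inj _ q)) qi
    -[p j == j](inj_eq (@perm_inj _ q)) qj.
(* There are [r - 1] ones of [v0] other than [i]; as [2 * m < r], they supply [m] disjoint pairs. *)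
pose es := enum [pred k | val v0 k && (k != i)].
have es_size : (2 * m <= size es)%N.
  rewrite -cardE -ltnS (leq_trans mr)//.
  apply: leq_trans (eq_leq (esym (card_vsupp v0))) _; rewrite (cardsD1 i).
  rewrite inE vi add1n ltnS; apply/subset_leq_card/fintype.subsetP => k.
  by rewrite !inE andbC.
have es_nth a : (a < 2 * m)%N -> [/\ val v0 (nth i es a), nth i es a != i
    & nth i es a != j].
  move=> am; have : nth i es a \in es by rewrite mem_nth// (leq_trans am).
  rewrite mem_enum inE => /andP[va ai]; split => //.
  by apply: contraNneq vj => <-.
pose k (b : 'I_m) := nth i es (2 * b).
pose k' (b : 'I_m) := nth i es (2 * b).+1.
have kP (b : 'I_m) : [/\ val v0 (k b), k b != i & k b != j].
  by apply: es_nth; have := ltn_ord b; lia.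
have k'P (b : 'I_m) : [/\ val v0 (k' b), k' b != i & k' b != j].
  by apply: es_nth; have := ltn_ord b; lia.
have nth_neq a c : (a < 2 * m)%N -> (c < 2 * m)%N -> a != c ->
    nth i es a != nth i es c.
  move=> am cm; rewrite nth_uniq ?enum_uniq//.
    exact: leq_trans am es_size.
  exact: leq_trans cm es_size.
have kk' (b : 'I_m) : k b != k' b.
  by apply: nth_neq; have := ltn_ord b; lia.
have kdisj (b c : 'I_m) : b != c ->
    [/\ k b != k c, k b != k' c, k' b != k c & k' b != k' c].
  move=> bc; have {}bc : nat_of_ord b <> c by move/val_inj/eqP; apply/negP.
  by split; apply: nth_neq; have := ltn_ord b; have := ltn_ord c; lia.
pose tau b := tperm (k b) (k' b).
(* This involution exchanges the pair [i, j] with the pair [k b, k' b], so it conjugates [t] into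
   [tau b]. *)
pose sw b := (tperm i (k b) * tperm j (k' b))%g.
pose hh b u := h (perm_vertex (sw b) u).
have ij : i != j by apply: contraNneq vj => <-.
have Htau b : H (tau b).
  have [vk ki kj] := kP b; have [vk' k'i k'j] := k'P b.
  rewrite /H /= !tpermD// !eqxx /=; apply/eqP/vertex_eqP => a.
  by rewrite perm_vertexE; case: tpermP => [->|->|//]; rewrite ?vk ?vk'.
have hh_anti b u : hh b (perm_vertex (tau b) u) = - hh b u.
  have [vk ki kj] := kP b; have [vk' k'i k'j] := k'P b.
  rewrite /hh -ht -!perm_vertexM; congr (h (perm_vertex _ _)).
  rewrite [RHS]conjgC tpermJ; congr (_ * tperm _ _)%g.
    by rewrite permM tpermL tpermD// 1?eq_sym.
  by rewrite permM (tpermD ij kj) tpermL.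
(* For [c] other than [b], [tau c] moves no point moved by [sw b]; hence the two commute, and
   [tau c] lies in [H]. *)
have hh_sym b c u : b != c -> hh b (perm_vertex (tau c) u) = hh b u.
  move=> bc; have [kk kk1 k'k k'k'] := kdisj _ _ bc.
  have [vk ki kj] := kP c; have [vk' k'i k'j] := k'P c.
  rewrite /hh -[RHS](hH (tau c))// -!perm_vertexM; congr (h (perm_vertex _ _)).
  rewrite [RHS]conjgC tpermJ; congr (_ * tperm _ _)%g.
    by rewrite permM !tpermD// 1?eq_sym.
  by rewrite permM !tpermD// 1?eq_sym.
rewrite -[m in m%:R]card_ord.
apply: (@eigenvalue_multiplicity_bound R _ 'I_m K l (\sum_v h v ^+ 2) hh).
- rewrite lt_neqAle sumr_ge0 ?andbT => [|v _]; last exact: sqr_ge0.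
  rewrite eq_sym psumr_neq0 => [|v _]; last exact: sqr_ge0.
  apply/hasP; exists v0; first exact: mem_index_enum.
  by rewrite /= exprn_even_gt0 ?hv0.
- move=> b; rewrite [RHS](reindex_inj (@perm_vertex_inj _ _ (sw b))) /=.
  exact: eq_bigr.
(* The change of variable by [tau c] fixes [hh b] and negates [hh c], so the inner product equals
   its own opposite. *)
- move=> b c bc; set S := \sum_v _.
  have : S = - S.
    rewrite {1}/S (reindex_inj (@perm_vertex_inj _ _ (tau c))) /= -sumrN.
    by apply: eq_bigr => v _; rewrite hh_anti hh_sym// mulrN.
  lra.
- by move=> b v; exact: eigen_perm.
Qed.

(** * Sizes of the Johnson graph *)

Lemma vsupp_surj n r (B : {set 'I_n}) : #|B| = r ->
  exists v : johnson_vertex n r, vsupp v = B.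
Proof.
move=> Br.
have h : (\sum_(i < n) [ffun i => i \in B] i == r)%N.
  rewrite -Br -sum1_card [X in _ == X]big_mkcond /=; apply/eqP/eq_bigr => i _.
  by rewrite ffunE; case: (i \in B).
exists (Sub [ffun i => i \in B] h).
by apply/setP => i; rewrite inE SubK ffunE.
Qed.

Lemma card_johnson_vertex n r : #|johnson_vertex n r| = 'C(n, r).
Proof.
rewrite -[n in RHS]card_ord -card_draws -(card_imset predT (@vsupp_inj n r)).
apply: eq_card => B; rewrite inE; apply/imsetP/eqP => [[v _ ->]|Br].
  exact: card_vsupp.
by have [v <-] := vsupp_surj Br; exists v.
Qed.

Lemma inner_productE n r (v w : johnson_vertex n r) :
  inner_product v w = #|vsupp v :&: vsupp w|%SET.
Proof.
rewrite -sum1_card [RHS]big_mkcond /=; apply: eq_bigr => i _.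
by rewrite !inE; case: (val v i); case: (val w i).
Qed.

(** A neighbour amounts to a choice of [s] of the [r] ones of [v] and of [r - s] of its [n - r]
    zeros. *)
Lemma card_johnson_neighbours n r s (v : johnson_vertex n r) : (s <= r)%N ->
  #|[set w | inner_product v w == s]%SET| = ('C(r, s) * 'C(n - r, r - s))%N.
Proof.
move=> sr; pose F (w : johnson_vertex n r) :=
  (vsupp w :&: vsupp v, vsupp w :\: vsupp v)%SET.
have F_inj : injective F.
  by move=> w w' [e1 e2]; apply: vsupp_inj; rewrite -(setID (vsupp w) (vsupp v)) e1 e2 setID.
have Cv : #|~: vsupp v|%SET = (n - r)%N.
  by have := cardsC (vsupp v); rewrite card_vsupp card_ord; lia.
have -> : 'C(r, s) = #|[set B : {set 'I_n} | B \subset vsupp v & #|B| == s]%SET|.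
  by rewrite cards_draws card_vsupp.
rewrite -(card_imset _ F_inj) -Cv -cards_draws -cardsX.
apply: eq_card => -[B1 B2]; rewrite !inE /=.
apply/imsetP/andP => [[w wv [-> ->]]|[/andP[B1v /eqP B1s] /andP[B2v /eqP B2s]]].
  move: wv; rewrite inE inner_productE finset.setIC => /eqP ws.
  split; apply/andP; split; rewrite ?finset.subsetIr ?ws ?eqxx//.
    by rewrite finset.setDE finset.subsetIr.
  by rewrite cardsD card_vsupp ws.
have B1in x : x \in B1 -> x \in vsupp v by apply: fintype.subsetP.
have B2in x : x \in B2 -> x \notin vsupp v.
  by move/(fintype.subsetP B2v); rewrite inE.
have B12 : (B1 :&: B2 = finset.set0)%SET.
  apply/setP => x; rewrite finset.in_setI finset.in_set0.
  by apply/negP => /andP[/B1in xv /B2in]; rewrite xv.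
have [|w wE] := @vsupp_surj n r (B1 :|: B2)%SET.
  by rewrite cardsU B12 cards0 B1s B2s; lia.
have e1 : (vsupp w :&: vsupp v = B1)%SET.
  apply/setP => x; rewrite wE finset.in_setI finset.in_setU.
  have := B1in x; have := B2in x.
  by case: (x \in B1); case: (x \in B2); case: (x \in vsupp v) => // a b;
    (try have := a isT) => //; (try have := b isT).
have e2 : (vsupp w :\: vsupp v = B2)%SET.
  apply/setP => x; rewrite wE finset.in_setD finset.in_setU.
  have := B1in x; have := B2in x.
  by case: (x \in B1); case: (x \in B2); case: (x \in vsupp v) => // a b;
    (try have := a isT) => //; (try have := b isT).
exists w; last by rewrite /F e1 e2.
by rewrite inE inner_productE finset.setIC e1 B1s.
Qed.

Lemma central_bin_rec k :
  ('C(k.+1.*2, k.+1) * k.+1 = 'C(k.*2, k) * (2 * k.*2.+1))%N.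
Proof.
have kk : (k <= k.*2)%N by rewrite -addnn leq_addr.
have h1 := @bin_fact k.+1.*2 k.+1; have h2 := @bin_fact k.*2 k.
have e1 : (k.+1.*2 - k.+1 = k.+1)%N by lia.
have e2 : (k.*2 - k = k)%N by lia.
have {}h1 : ('C(k.+1.*2, k.+1) * (k.+1`! * k.+1`!) = k.+1.*2`!)%N.
  by rewrite -h1 ?e1//; lia.
have {}h2 : ('C(k.*2, k) * (k`! * k`!) = k.*2`!)%N.
  by rewrite -h2 ?e2.
have f0 := fact_gt0 k.
apply/eqP; rewrite -(@eqn_pmul2r (k.+1 * (k`! * k`!))) ?muln_gt0 ?f0//; apply/eqP.
transitivity ('C(k.+1.*2, k.+1) * (k.+1`! * k.+1`!))%N; first by rewrite factS; lia.
rewrite h1 doubleS !factS -h2; lia.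
Qed.

(** The estimate 4^k / (2 sqrt k) for the central binomial, squared to stay in the naturals. By the
    recurrence, the induction step at [k] reduces to 4k(k + 1) <= (2k + 1)^2. *)
Lemma central_bin_lower k : (16 ^ k <= 'C(k.*2, k) ^ 2 * (4 * k))%N || (k == 0).
Proof.
case: k => // k; rewrite orbF; elim: k => // k IH.
have := central_bin_rec k.+1; set b := 'C(k.+1.*2, k.+1); set c := 'C(_, _) => e.
rewrite -(@leq_pmul2r (k.+2 ^ 2)) ?expn_gt0//.
have -> : (c ^ 2 * (4 * k.+2) * k.+2 ^ 2 = (c * k.+2) ^ 2 * (4 * k.+2))%N by lia.
rewrite e.
have -> : ((b * (2 * k.+1.*2.+1)) ^ 2 * (4 * k.+2) =
  b ^ 2 * (16 * (k.+2 * k.+1.*2.+1 ^ 2)))%N by lia.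
rewrite (expnS 16 k.+1).
have le1 : (k.+2 ^ 2 * (4 * k.+1) <= k.+2 * k.+1.*2.+1 ^ 2)%N by nia.
apply: (@leq_trans (16 * (b ^ 2 * (4 * k.+1)) * k.+2 ^ 2)).
  by rewrite leq_mul2r leq_mul2l IH !orbT.
apply: (@leq_trans (b ^ 2 * (16 * (k.+2 ^ 2 * (4 * k.+1))))); first lia.
by rewrite leq_mul2l leq_mul2l le1 !orbT.
Qed.

(** The matching upper estimate 4^k / sqrt(2k + 1); the step reduces to (2k + 1)(2k + 3) <= 4(k +
    1)^2. *)
Lemma central_bin_upper k : ('C(k.*2, k) ^ 2 * k.*2.+1 <= 16 ^ k)%N.
Proof.
elim: k => // k IH.
have := central_bin_rec k; set b := 'C(k.*2, k); set c := 'C(_, _) => e.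
rewrite -(@leq_pmul2r (k.+1 ^ 2)) ?expn_gt0//.
have -> : (c ^ 2 * k.+1.*2.+1 * k.+1 ^ 2 = (c * k.+1) ^ 2 * k.+1.*2.+1)%N by lia.
rewrite e (expnS 16 k).
have -> : ((b * (2 * k.*2.+1)) ^ 2 * k.+1.*2.+1 =
  b ^ 2 * k.*2.+1 * (4 * (k.*2.+1 * k.+1.*2.+1)))%N by lia.
rewrite (mulnC 16%N) -[leqRHS]mulnA leq_mul//; nia.
Qed.

(** * Edges inside the parts of a partition *)

Lemma handshake (V : finType) (S : {set {set V}}) :
  (forall e, e \in S -> #|e| = 2%N) -> (\sum_v degree S v = 2 * #|S|)%N.
Proof.
move=> S2; rewrite /degree.
under eq_bigr do rewrite -sum1_card.
rewrite (exchange_big_dep (mem S)) /= => [|v e _]; last by rewrite inE => /andP[].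
rewrite -sum1_card big_distrr /=; apply: eq_bigr => e eS.
rewrite muln1 -[RHS](S2 e eS) -sum1_card; by apply: eq_bigl => v; rewrite inE eS.
Qed.

(* Colourings V -> V stand for partitions in the union bound: there are exactly
   #|V| ^ #|V| of them. *)
Definition monochromatic (V : finType) (c : {ffun V -> V}) (S : {set {set V}}) :
    {set {set V}} :=
  [set e in S | [forall u in e, forall w in e, c u == c w]]%SET.

(** Each vertex is coloured by a chosen representative of its part. One colouring serves every edge
    set, hence both the random graph and the full one. Edges must be nonempty, since an empty one
    would be counted once per part. *)
Lemma partition_colouring (V : finType) (Q : {set {set V}}) :
  finset.partition Q [set: V]%SET ->
  exists c : {ffun V -> V}, forall S : {set {set V}},
    (forall e, e \in S -> e != finset.set0) ->
    (\sum_(A in Q) edges_within S A)%N = #|monochromatic c S|.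
Proof.
move=> /and3P[/eqP covQ tQ _].
have incov v : v \in finset.cover Q by rewrite covQ inE.
(* The default [v] is never taken, because the block of [v] contains [v]; so the colour depends on
   the block only. *)
pose c := [ffun v => odflt v [pick u in finset.pblock Q v]].
have cin v : c v \in finset.pblock Q v.
  rewrite ffunE; case: pickP => [//|/(_ v)].
  by rewrite finset.mem_pblock incov.
have cE u w : (c u == c w) = (finset.pblock Q u == finset.pblock Q w).
  apply/eqP/eqP => [cuw|uw].
    by rewrite -(finset.same_pblock tQ (cin u)) cuw (finset.same_pblock tQ (cin w)).
  rewrite !ffunE uw; case: pickP => // /(_ w).
  by rewrite finset.mem_pblock incov.
exists c => S S0; rewrite /edges_within.
under eq_bigr do rewrite -sum1_card.
rewrite (exchange_big_dep (mem S)) /= => [|A e _]; last by rewrite inE => /andP[].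
rewrite -sum1_card [RHS](eq_bigl (fun e => (e \in S) &&
  [forall u in e, forall w in e, c u == c w])) => [|e]; last by rewrite inE.
rewrite [RHS]big_mkcondr /=; apply: eq_bigr => e eS.
have /set0Pn[x xe] := S0 e eS.
have subA A : A \in Q -> e \subset A -> A = finset.pblock Q x.
  by move=> AQ /fintype.subsetP eA; apply/esym/(finset.def_pblock tQ AQ)/eA.
case: ifPn => [/forall_inP mono|nmono].
  rewrite (big_pred1 (finset.pblock Q x)) // => A; rewrite inE eS /=.
  apply/andP/eqP => [[AQ /subA ->]//|->].
  split; first exact: finset.pblock_mem.
  apply/fintype.subsetP => u ue; have /forall_inP /(_ x xe) := mono u ue.
  by rewrite cE => /eqP <-; rewrite finset.mem_pblock.
rewrite big1// => A /andP[AQ]; rewrite inE eS /= => eA.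
case/negP: nmono; apply/forall_inP => u ue; apply/forall_inP => w we.
move: eA => /fintype.subsetP eA.
by rewrite cE !(finset.def_pblock tQ AQ) ?eA.
Qed.

Lemma sum_card_sqr_le (R : realType) (V : finType) (Q : {set {set V}}) :
  finset.partition Q [set: V]%SET ->
  \sum_(A in Q) (#|A|%:R / #|V|%:R) ^+ 2 <= 1 :> R.
Proof.
move=> /card_partition; rewrite cardsT => cQ.
have [V0|V0] := posnP #|V|.
  by rewrite V0 big1 ?ler01// => A _; rewrite invr0 mulr0 expr0n.
have V0' : 0 < #|V|%:R :> R by rewrite ltr0n.
have e : \sum_(A in Q) #|A|%:R / #|V|%:R = 1 :> R.
  by rewrite -mulr_suml -natr_sum -cQ divff ?gt_eqF.
rewrite -[leRHS]e; apply: ler_sum => A _; rewrite expr2 ler_piMr//.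
by rewrite ler_pdivrMr// mul1r ler_nat max_card.
Qed.

(** * Degrees, edge counts and partitions of the Johnson graph *)

Lemma johnson_graphP n r s e :
  reflect (exists u v : johnson_vertex n r,
    [/\ u != v, inner_product u v = s & e = [set u; v]%SET])
  (e \in johnson_graph n r s).
Proof.
apply: (iffP imsetP) => [[[u v] /=]|[u [v [uv /eqP us ->]]]].
  by rewrite inE /= => /andP[uv /eqP us ->]; exists u, v.
by exists (u, v) => //; rewrite inE /= uv.
Qed.

Lemma johnson_edge_card n r s e : e \in johnson_graph n r s -> #|e| = 2%N.
Proof. by move=> /johnson_graphP[u [v [uv _ ->]]]; rewrite cards2 uv. Qed.

Lemma inner_productC n r (v w : johnson_vertex n r) :
  inner_product v w = inner_product w v.
Proof. by rewrite !inner_productE finset.setIC. Qed.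

Lemma johnson_degree_within n r s (A : {set johnson_vertex n r}) v : (s < r)%N ->
  degree [set e in johnson_graph n r s | e \subset A]%SET v =
  if v \in A then #|[set w in A | inner_product v w == s]%SET| else 0%N.
Proof.
move=> sr; rewrite /degree; case: ifPn => vA; last first.
  apply/eqP; rewrite cards_eq0; apply/eqP/setP => e; rewrite !inE.
  apply/negP => /andP[/andP[_ /fintype.subsetP eA] /eA].
  exact/negP.
(* A vertex has inner product [r] with itself, so [s < r] rules out loops. *)
have adj_neq w : inner_product v w == s -> v != w.
  apply: contraTneq => <-.
  by rewrite inner_productE finset.setIid card_vsupp gtn_eqF.
have pair_inj : {in [set w in A | inner_product v w == s]%SET &,
    injective (fun w => [set v; w]%SET)}.
  move=> w w'; rewrite !inE => /andP[_ /adj_neq vw] /andP[_ /adj_neq vw'] e.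
  have : w \in [set v; w']%SET by rewrite -e !inE eqxx orbT.
  by rewrite !inE eq_sym (negbTE vw) => /eqP.
rewrite -(card_in_imset pair_inj); apply: eq_card => e; rewrite !inE.
apply/andP/imsetP => [[/andP[/johnson_graphP[u [w [uw us ->]]] uA] ve]|].
  move: uA; rewrite finset.subUset !finset.sub1set => /andP[uA wA].
  move: ve; rewrite !inE => /orP[] /eqP ve.
    by exists w; rewrite ?ve// inE wA us eqxx.
  by exists u; rewrite ?ve 1?finset.setUC// inE uA inner_productC us eqxx.
move=> [w]; rewrite inE => /andP[wA vw] ->.
rewrite finset.subUset !finset.sub1set vA wA !inE eqxx /= andbT; split=> //.
apply/johnson_graphP; exists v, w; split=> //.
  exact: adj_neq.
exact/eqP.
Qed.

(** Handshake in the subgraph induced on [A]. The right side is the quadratic form of the adjacency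
    matrix at the indicator of [A], ready for the Rayleigh bound. *)
Lemma johnson_edges_within n r s (A : {set johnson_vertex n r}) : (s < r)%N ->
  (2 * edges_within (johnson_graph n r s) A =
  \sum_(v in A) \sum_(w in A) (inner_product v w == s))%N.
Proof.
move=> sr; rewrite /edges_within -handshake => [|e]; last first.
  by rewrite inE => /andP[/johnson_edge_card].
rewrite [RHS]big_mkcond /=; apply: eq_bigr => v _.
rewrite johnson_degree_within//; case: ifP => // _.
rewrite -sum1_card big_mkcond [RHS]big_mkcond /=; apply: eq_bigr => w _.
by rewrite inE; case: (w \in A) => //=; case: eqP.
Qed.

Lemma johnson_degree n r s v : (s < r)%N ->
  degree (johnson_graph n r s) v = ('C(r, s) * 'C(n - r, r - s))%N.
Proof.
move=> sr; rewrite -(card_johnson_neighbours v (ltnW sr)).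
have := johnson_degree_within [set: johnson_vertex n r]%SET v sr; rewrite finset.in_setT.
have -> : [set e in johnson_graph n r s | e \subset [set: johnson_vertex n r]]%SET =
    johnson_graph n r s.
  by apply/setP => e; rewrite inE finset.subsetT andbT.
by move=> ->; apply: eq_card => w; rewrite !inE.
Qed.

Lemma card_johnson_graph n r s : (s < r)%N ->
  (2 * #|johnson_graph n r s| = 'C(n, r) * ('C(r, s) * 'C(n - r, r - s)))%N.
Proof.
move=> sr; rewrite -handshake; last exact: johnson_edge_card.
rewrite (eq_bigr _ (fun v _ => johnson_degree v sr)) sum_nat_const.
by rewrite -[in RHS](card_johnson_vertex n r).
Qed.

(** This says N / D <= 2 sqrt s. It combines the upper estimate for the binomial of order [2 * s]
    with the square of the lower estimate for that of order [s]. *)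
Lemma johnson_ratio s : (0 < s)%N ->
  ('C(4 * s, 2 * s) ^ 2 <= 4 * s * ('C(2 * s, s) * 'C(2 * s, s)) ^ 2)%N.
Proof.
move=> s0; have := central_bin_lower s; rewrite [s == 0%N]gtn_eqF// orbF.
have := central_bin_upper s.*2.
have -> : (s.*2.*2 = 4 * s)%N by lia.
have -> : (s.*2 = 2 * s)%N by lia.
set N := 'C(_, _); set B := 'C(_, _) => up low.
have {}up : (N ^ 2 * (4 * s).+1 <= 16 ^ s * 16 ^ s)%N.
  by rewrite -expnD addnn -mul2n.
have {}up := leq_trans up (leq_mul low low).
rewrite -(@leq_pmul2r (4 * s).+1)// (leq_trans up)//.
have -> : (B ^ 2 * (4 * s) * (B ^ 2 * (4 * s)) = (B * B) ^ 2 * (16 * s ^ 2))%N by lia.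
have -> : (4 * s * (B * B) ^ 2 * (4 * s).+1 = (B * B) ^ 2 * (16 * s ^ 2 + 4 * s))%N by lia.
by rewrite leq_mul2l leq_addr orbT.
Qed.

(** At the indicator of a part [A], the form of [K] is 2 e(A) - D |A|^2 / N, at most l |A|. Summing
    over the parts and dividing by 2 e(G) = N D leaves the error l / D. *)
Lemma johnson_partition_bound (R : realType) s
    (Q : {set {set johnson_vertex (4 * s) (2 * s)}}) :
  (2 <= s)%N -> finset.partition Q [set: johnson_vertex (4 * s) (2 * s)]%SET ->
  (\sum_(A in Q) edges_within (johnson_graph (4 * s) (2 * s) s) A)%:R /
    #|johnson_graph (4 * s) (2 * s) s|%:R <=
  \sum_(A in Q) (#|A|%:R / #|johnson_vertex (4 * s) (2 * s)|%:R) ^+ 2 +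
    2 / Num.sqrt (Num.sqrt s%:R) :> R.
Proof.
set V := johnson_vertex _ _; set E := johnson_graph _ _ _ => s2 partQ.
have ss : (s < 2 * s)%N by lia.
have ms : (2 * s.-1 < 2 * s)%N by lia.
have s1 : 0 < s.-1%:R :> R by rewrite ltr0n; lia.
have sE : s%:R = s.-1%:R + 1 :> R by rewrite natr1 prednK//; lia.
have s1' : 1 <= s.-1%:R :> R by rewrite ler1n; lia.
pose Dn := ('C(2 * s, s) * 'C(2 * s, s))%N.
have deg (v : V) : #|[set w | inner_product v w == s]%SET| = Dn.
  rewrite card_johnson_neighbours; last lia.
  by rewrite /Dn; congr (_ * 'C(_, _))%N; lia.
have cardE : (2 * #|E| = #|V| * Dn)%N.
  rewrite card_johnson_graph// card_johnson_vertex /Dn.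
  by congr (_ * (_ * 'C(_, _)))%N; lia.
have ratio : (#|V| ^ 2 <= 4 * s * Dn ^ 2)%N.
  by rewrite card_johnson_vertex; apply: johnson_ratio; lia.
have V0 : (0 < #|V|)%N by rewrite card_johnson_vertex bin_gt0; lia.
have D0 : (0 < Dn)%N by rewrite muln_gt0 bin_gt0; lia.
clearbody Dn.
pose N : R := #|V|%:R; pose D : R := Dn%:R.
have N0 : 0 < N by rewrite ltr0n.
have Nn0 : N != 0 by rewrite gt_eqF.
have DR0 : 0 < D by rewrite ltr0n.
pose M (v w : V) : R := (inner_product v w == s)%:R.
pose K (v w : V) : R := M v w - D / N.
have sumM v : \sum_w M v w = D.
  rewrite /D -(deg v) -sum1_card natr_sum [RHS]big_mkcond /=.
  by apply: eq_bigr => w _; rewrite inE /M; case: eqP.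
have sumK v : \sum_w K v w = 0.
  by rewrite sumrB sumM sumr_const -[X in _ - X]mulr_natr divfK ?gt_eqF ?subrr.
have frobK : \sum_v \sum_w K v w ^+ 2 <= N * D.
  rewrite [N]/(#|V|%:R) mulrC mulr_natr -sumr_const; apply: ler_sum => v _.
  (* Since [M] takes the values 0 and 1, the square of [K] is affine in [M]. *)
  have -> : \sum_w K v w ^+ 2 = D - D ^+ 2 / N.
    transitivity (\sum_w ((1 - 2 * (D / N)) * M v w + (D / N) ^+ 2)).
      by apply: eq_bigr => w _; rewrite /K /M; case: eqP => _ /=; ring.
    rewrite big_split -mulr_sumr sumM sumr_const -(mulr_natr ((D / N) ^+ 2)) /=.
    by rewrite -/N; field.
  by rewrite gerBl divr_ge0// ?sqr_ge0 ?ltW.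
have [l [f [[v0 f0] fK ub]]] : exists (l : R) (f : V -> R), [/\ exists v, f v != 0,
    forall v, \sum_w K v w * f w = l * f v
  & forall x : V -> R,
      \sum_v \sum_w K v w * x v * x w <= l * \sum_v x v ^+ 2].
  by apply: max_eigenvector => // v w; rewrite /K /M inner_productC.
pose d : R := 2 / Num.sqrt (Num.sqrt s%:R).
have s0 : 0 < s%:R :> R by rewrite ltr0n; lia.
have d0 : 0 <= d by rewrite divr_ge0// sqrtr_ge0.
have lD : l <= d * D.
  have dD0 : 0 <= d * D by rewrite mulr_ge0// ltW.
  have [l0|l0] := lerP l 0; first exact: le_trans l0 dD0.
  (* Constants are in the kernel of [K], so they cannot have a positive eigenvalue. *)
  have nonconst : exists v w, f v <> f w.
    apply: contrapT => nex.
    have fc w : f w = f v0.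
      by apply: contrapT => fw; apply: nex; exists w, v0.
    have := fK v0; rewrite (eq_bigr (fun w => K v0 w * f v0)) => [|w _]; last first.
      by rewrite fc.
    rewrite -mulr_suml sumK mul0r => /esym/eqP.
    by rewrite mulf_eq0 gt_eqF//= (negbTE f0).
  have H : l ^+ 2 * s.-1%:R <= N * D.
    apply: le_trans frobK; apply: (johnson_eigenvalue_bound ms _ fK nonconst).
    by move=> p v w; rewrite /K /M inner_product_perm.
  have d4 : d ^+ 4 * s%:R = 16.
    rewrite exprMn exprVn.
    have -> : Num.sqrt (Num.sqrt s%:R) ^+ 4 = s%:R :> R.
      by rewrite (exprM _ 2 2) sqr_sqrtr ?sqrtr_ge0// sqr_sqrtr// ltW.
    by rewrite -mulrA mulVf ?gt_eqF// mulr1 -natrX.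
  (* Fourth powers clear the nested roots: l^4 (s - 1)^2 <= (N D)^2 <= 4 s D^4 and d^4 s = 16, so it
     remains to see 4 s^2 <= 16 (s - 1)^2, which holds from s = 2 on. *)
  rewrite -(@ler_pXn2r _ 4) ?nnegrE ?(ltW l0)//.
  have NR : N ^+ 2 <= 4 * s%:R * D ^+ 2 by rewrite -!natrX -!natrM ler_nat.
  rewrite -(ler_pM2r (exprn_gt0 2 s1)) -(ler_pM2r s0).
  apply: (@le_trans _ _ ((4 * s%:R * D ^+ 2) * D ^+ 2 * s%:R)).
    rewrite ler_pM2r//.
    apply: (@le_trans _ _ ((N * D) ^+ 2)).
      have -> : l ^+ 4 * s.-1%:R ^+ 2 = (l ^+ 2 * s.-1%:R) ^+ 2 by ring.
      by rewrite ler_pXn2r// nnegrE mulr_ge0 ?sqr_ge0 ?(ltW s1) ?(ltW N0) ?(ltW DR0).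
    by rewrite exprMn ler_wpM2r// sqr_ge0.
  have -> : (d * D) ^+ 4 * s.-1%:R ^+ 2 * s%:R =
    (d ^+ 4 * s%:R) * s.-1%:R ^+ 2 * D ^+ 4 by ring.
  rewrite d4 sE.
  have -> : 4 * (s.-1%:R + 1) * D ^+ 2 * D ^+ 2 * (s.-1%:R + 1) =
    (4 * (s.-1%:R + 1) ^+ 2) * D ^+ 4 :> R by ring.
  apply: ler_wpM2r; first exact/exprn_ge0/ltW.
  rewrite -subr_ge0.
  have -> : 16 * s.-1%:R ^+ 2 - 4 * (s.-1%:R + 1) ^+ 2 =
    4 * ((s.-1%:R - 1) * (3 * s.-1%:R + 1)) :> R by ring.
  by rewrite !mulr_ge0 ?subr_ge0 ?addr_ge0 ?mulr_ge0// ltW.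
have cardER : #|E|%:R = N * D / 2 :> R.
  by rewrite /N /D -natrM -cardE natrM mulrC mulKf// pnatr_eq0.
have ubQ : \sum_(A in Q) (2 * edges_within E A)%:R -
    D / N * \sum_(A in Q) #|A|%:R ^+ 2 <= l * N.
  have -> : l * N = \sum_(A in Q) l * #|A|%:R.
    by rewrite -mulr_sumr -natr_sum -(card_partition partQ) cardsT.
  rewrite mulr_sumr -sumrB; apply: ler_sum => A _.
  have := ub (fun v => (v \in A)%:R).
  have -> : \sum_v (v \in A)%:R ^+ 2 = #|A|%:R :> R.
    rewrite -sum1_card natr_sum [RHS]big_mkcond /=; apply: eq_bigr => v _.
    by case: (v \in A); rewrite ?expr1n ?expr0n.
  congr (_ <= _).
  rewrite johnson_edges_within// natr_sum.
  transitivity (\sum_(v in A) \sum_(w in A) (M v w - D / N)).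
    rewrite [RHS]big_mkcond /=; apply: eq_bigr => v _.
    rewrite [in RHS]big_mkcond /=; case: ifP => vA; last first.
      by rewrite big1// => w _; rewrite mulr0 mul0r.
    by apply: eq_bigr => w _; rewrite /K; case: (w \in A) => /=; ring.
  rewrite (eq_bigr (fun v => \sum_(w in A) M v w - D / N * #|A|%:R)) => [|v _].
    rewrite sumrB sumr_const -(mulr_natr (D / N * #|A|%:R)) -mulrA -expr2; congr (_ - _).
    by apply: eq_bigr => v _; rewrite natr_sum.
  by rewrite sumrB sumr_const mulr_natr.
rewrite cardER.
have -> : \sum_(A in Q) (#|A|%:R / #|V|%:R) ^+ 2 =
    (\sum_(A in Q) #|A|%:R ^+ 2) / N ^+ 2 :> R.
  by rewrite mulr_suml; apply: eq_bigr => A _; rewrite expr_div_n.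
rewrite -/d.
move: ubQ; rewrite -natr_sum -big_distrr natrM /=.
move: (\sum_(A in Q) edges_within E A)%N => e; move: (\sum_(A in Q) _) => Z ubQ.
have lN : l * N <= d * D * N by rewrite ler_pM2r.
rewrite ler_pdivrMr ?divr_gt0 ?mulr_gt0//.
have -> : (Z / N ^+ 2 + d) * (N * D / 2) = (D / N * Z + d * D * N) / 2 by field.
lra.
Qed.

(** * Chernoff bounds for random edge sets *)

(** The law of a random set of retained elements as finite weights, specified by its avoidance
    probabilities; [B] empty gives total mass 1. *)
Definition independent_retention (R : realType) (X : finType) (E : {set X}) (p : R)
    (mu : {set X} -> R) : Prop :=
  (forall S, 0 <= mu S) /\
  forall B : {set X}, B \subset E ->
    \sum_(S : {set X} | (B :&: S == finset.set0)%SET) mu S = (1 - p) ^+ #|B|.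

(* The set [B] to be avoided makes the induction on [F] possible: the weight
   [a ^+ (e \in S)] equals [a + (1 - a) * (e \notin S)], and the second summand
   moves [e] from [F] to [B]. *)
Lemma retention_mgf_avoiding (R : realType) (X : finType) (E : {set X}) (p a : R)
    (mu : {set X} -> R) (B F : {set X}) :
  independent_retention E p mu -> B \subset E -> F \subset E ->
  (B :&: F)%SET = finset.set0 ->
  \sum_(S : {set X} | (B :&: S == finset.set0)%SET) mu S * a ^+ #|S :&: F|%SET =
  (1 - p) ^+ #|B| * (1 - p + p * a) ^+ #|F|.
Proof.
move=> [_ hmu]; have [n] := ubnP #|F|.
elim: n B F => // n IH B F; rewrite ltnS => Fn BE FE BF.
have [->|/set0Pn[e eF]] := eqVneq F finset.set0.
  rewrite cards0 expr0 mulr1 -hmu//; apply: eq_bigr => S _.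
  by rewrite finset.setI0 cards0 expr0 mulr1.
have eE : e \in E by exact: (fintype.subsetP FE).
have eB : e \notin B.
  by apply/negP => eB; move/setP: BF => /(_ e); rewrite !inE eB eF.
pose F' := (F :\ e)%SET.
have cF : #|F| = #|F'|.+1 by rewrite (cardsD1 e) eF.
have F'E : F' \subset E by rewrite (fintype.subset_trans _ FE)// finset.subsetDl.
have BF' : (B :&: F')%SET = finset.set0.
  apply/eqP; rewrite -finset.subset0 -BF.
  by apply: finset.setIS; exact: finset.subsetDl.
have F'n : (#|F'| < n)%N by rewrite -cF.
pose B' := (e |: B)%SET.
have B'E : B' \subset E by rewrite finset.subUset finset.sub1set eE.
have B'F' : (B' :&: F')%SET = finset.set0.
  apply/setP => x; rewrite !inE; case: eqVneq => //= _.
  by move/setP: BF => /(_ x); rewrite !inE.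
transitivity (a * (\sum_(S : {set X} | (B :&: S == finset.set0)%SET)
      mu S * a ^+ #|S :&: F'|%SET) +
    (1 - a) * \sum_(S : {set X} | (B' :&: S == finset.set0)%SET)
      mu S * a ^+ #|S :&: F'|%SET).
  have -> : \sum_(S : {set X} | (B' :&: S == finset.set0)%SET)
        mu S * a ^+ #|S :&: F'|%SET =
      \sum_(S : {set X} | (B :&: S == finset.set0)%SET)
        (if e \notin S then mu S * a ^+ #|S :&: F'|%SET else 0).
    rewrite -big_mkcondr /=; apply: eq_bigl => S.
    rewrite finset.setIUl finset.setU_eq0 andbC; congr (_ && _).
    by rewrite finset.setI_eq0 disjoints1.
  rewrite !mulr_sumr -big_split /=; apply: eq_bigr => S _.
  rewrite (cardsD1 e (S :&: F)%SET) !inE eF andbT.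
  have -> : (S :&: F :\ e = S :&: F')%SET by rewrite finset.setIDA.
  by case: (e \in S) => /=; rewrite ?add1n ?exprS ?add0n; ring.
rewrite !IH// cardsU1 eB add1n cF !exprS; ring.
Qed.

(** At [a = expR t] this is the moment generating function of a binomial variable with [#|F|]
    trials. *)
Lemma retention_mgf (R : realType) (X : finType) (E : {set X}) (p a : R)
    (mu : {set X} -> R) (F : {set X}) :
  independent_retention E p mu -> F \subset E ->
  \sum_(S : {set X}) mu S * a ^+ #|S :&: F|%SET = (1 - p + p * a) ^+ #|F|.
Proof.
move=> hmu FE.
have := retention_mgf_avoiding a hmu (finset.sub0set E) FE (finset.set0I F).
rewrite cards0 expr0 mul1r => <-; apply: eq_bigl => S.
by rewrite finset.set0I eqxx.
Qed.

(** Inverting 1 - t <= exp(-t) gives exp t <= 1 / (1 - t). Negative [t] is allowed, for the lower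
    tail. *)
Lemma expR_le_quadratic (R : realType) (t : R) : t <= 1 / 2 ->
  expR t <= 1 + t + 2 * t ^+ 2.
Proof.
move=> t2.
have h : 1 - t <= expR (- t) by have := @expR_ge1Dx R (- t).
have t1 : 0 < 1 - t by lra.
have : expR t <= (1 - t)^-1.
  by rewrite -[t in expR t]opprK expRN lef_pV2// posrE ?expR_gt0.
move=> /le_trans; apply; rewrite -div1r ler_pdivrMr//.
have -> : (1 + t + 2 * t ^+ 2) * (1 - t) = 1 + t ^+ 2 * (1 - 2 * t) by ring.
by rewrite lerDl mulr_ge0 ?sqr_ge0//; lra.
Qed.

(** Markov's inequality for exp(t |S n F|), followed by 1 + u <= exp u. The sign of [t] selects the
    tail. *)
Lemma chernoff_bound (R : realType) (X : finType) (E : {set X}) (p t x : R)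
    (mu : {set X} -> R) (F : {set X}) :
  0 <= p <= 1 -> t <= 1 / 2 -> independent_retention E p mu -> F \subset E ->
  \sum_(S : {set X} | x <= t * #|S :&: F|%SET%:R) mu S <=
    expR (p * #|F|%:R * (t + 2 * t ^+ 2) - x).
Proof.
move=> /andP[p0 p1] t2 hmu FE.
have mu0 S : 0 <= mu S by exact: hmu.1.
apply: (@le_trans _ _ (expR (- x) *
    \sum_(S : {set X}) mu S * expR t ^+ #|S :&: F|%SET)).
  rewrite mulr_sumr big_mkcond /=; apply: ler_sum => S _; case: ifPn => [xS|_].
    rewrite mulrCA ler_peMr// -expRM_natl -expRD.
    by rewrite -[leLHS]expR0 ler_expR [_ * t]mulrC; lra.
  by rewrite !mulr_ge0 ?exprn_ge0 ?expR_ge0.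
rewrite (retention_mgf _ hmu FE) addrC expRD mulrC ler_wpM2r ?expR_ge0//.
rewrite -mulrA mulrCA expRM_natl.
have e0 := expR_ge0 t.
apply: lerXn2r; rewrite ?nnegrE ?expR_ge0//.
  by apply: addr_ge0; rewrite ?mulr_ge0 ?subr_ge0.
have := @expR_ge1Dx R (p * (t + 2 * t ^+ 2)).
apply: le_trans.
have := ler_wpM2l p0 (expR_le_quadratic t2); lra.
Qed.

(** The deviation is measured against [m], which may exceed [#|F|]: small sets of monochromatic
    edges then obey the same bound as large ones. *)
Lemma chernoff_upper (R : realType) (X : finType) (E : {set X}) (p eps m : R)
    (mu : {set X} -> R) (F : {set X}) :
  0 <= p <= 1 -> 0 < eps <= 2 -> independent_retention E p mu -> F \subset E ->
  #|F|%:R <= m ->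
  \sum_(S : {set X} | p * #|F|%:R + eps * p * m <= #|S :&: F|%SET%:R) mu S <=
    expR (- (eps ^+ 2 * (p * m) / 8)).
Proof.
move=> p01 /andP[e0 e2] hmu FE Fm; have /andP[p0 p1] := p01.
(* With t = eps / 4 the exponent is eps^2 p |F| / 8 - eps^2 p m / 4. *)
have e4 : 0 < eps / 4 by lra.
rewrite (eq_bigl (fun S : {set X} => eps / 4 * (p * #|F|%:R + eps * p * m) <=
  eps / 4 * #|S :&: F|%SET%:R)) => [|S]; last by rewrite ler_pM2l.
have e4' : eps / 4 <= 1 / 2 by lra.
apply: (le_trans (chernoff_bound _ p01 e4' hmu FE)); rewrite ler_expR.
have : eps ^+ 2 * (p * #|F|%:R) <= eps ^+ 2 * (p * m).
  by rewrite ler_wpM2l ?sqr_ge0// ler_wpM2l.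
lra.
Qed.

Lemma chernoff_lower (R : realType) (X : finType) (E : {set X}) (p eps m : R)
    (mu : {set X} -> R) (F : {set X}) :
  0 <= p <= 1 -> 0 < eps <= 2 -> independent_retention E p mu -> F \subset E ->
  #|F|%:R <= m ->
  \sum_(S : {set X} | #|S :&: F|%SET%:R <= p * #|F|%:R - eps * p * m) mu S <=
    expR (- (eps ^+ 2 * (p * m) / 8)).
Proof.
move=> p01 /andP[e0 e2] hmu FE Fm; have /andP[p0 p1] := p01.
have e4 : - (eps / 4) < 0 by lra.
rewrite (eq_bigl (fun S : {set X} => - (eps / 4) * (p * #|F|%:R - eps * p * m) <=
  - (eps / 4) * #|S :&: F|%SET%:R)) => [|S]; last by rewrite ler_nM2l.
have e4' : - (eps / 4) <= 1 / 2 by lra.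
apply: (le_trans (chernoff_bound _ p01 e4' hmu FE)); rewrite ler_expR.
have : eps ^+ 2 * (p * #|F|%:R) <= eps ^+ 2 * (p * m).
  by rewrite ler_wpM2l ?sqr_ge0// ler_wpM2l.
lra.
Qed.

(** * Modularity of almost regular graphs *)

Lemma singleton_partitionP (V : finType) :
  finset.partition (singleton_partition V) [set: V]%SET.
Proof.
apply/and3P; split.
- apply/eqP/setP => v; rewrite !inE; apply/bigcupP; exists [set v]%SET.
    by apply/imsetP; exists v.
  by rewrite inE.
- apply/finset.trivIsetP => A B /imsetP[a _ ->] /imsetP[b _ ->] ab.
  rewrite disjoints1 inE; apply: contra ab => /eqP ->; exact: eqxx.
- apply/negP => /imsetP[v _ /setP /(_ v)]; rewrite !inE eqxx//.
Qed.

Lemma modularity_le (R : realType) (V : finType) (S : {set {set V}}) (b : R) :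
  (forall Q, finset.partition Q [set: V]%SET -> modularity_score R S Q <= b) ->
  modularity R S <= b.
Proof.
move=> Qb; apply: bigmax_le => [|Q]; last exact: Qb.
exact/Qb/singleton_partitionP.
Qed.

(** The partition with a single part has score 1 - 1 = 0, or 0 - 0 when there are no edges. *)
Lemma modularity_ge0 (R : realType) (V : finType) (S : {set {set V}}) :
  (0 < #|V|)%N -> (forall e, e \in S -> #|e| = 2%N) -> 0 <= modularity R S.
Proof.
move=> V0 S2.
have partT : finset.partition [set [set: V]]%SET [set: V]%SET.
  apply/and3P; split.
  - by rewrite /finset.cover big_set1.
  - by apply/finset.trivIsetP => A B; rewrite !inE => /eqP -> /eqP ->; rewrite eqxx.
  - by rewrite inE eq_sym -card_gt0 cardsT.
apply: (@le_trans _ _ (modularity_score R S [set [set: V]]%SET)); last first.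
  exact: (@le_bigmax_cond _ _ _ _ _ (fun Q => finset.partition Q [set: V]%SET) (modularity_score R S) partT).
rewrite /modularity_score !big_set1.
have -> : (\sum_(v in [set: V]%SET) degree S v = 2 * #|S|)%N.
  by rewrite -handshake//; apply: eq_bigl => v; rewrite inE.
have -> : edges_within S [set: V]%SET = #|S|.
  by apply: eq_card => e; rewrite inE finset.subsetT andbT.
have [->|S0] := eqVneq #|S| 0%N; first by rewrite !mul0r muln0 expr0n mul0r subr0.
have SR : #|S|%:R != 0 :> R by rewrite pnatr_eq0.
by rewrite natrM le_eqVlt eq_sym subr_eq0; apply/orP; left; apply/eqP; field.
Qed.

(** Here [y] stands for p e(E) / e(S) and [Z] for the sum of squared relative part sizes. As [y]
    lies between [1 - eps] and 2, the two multiples of [Z] cancel up to 6 eps. *)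
Lemma score_arith (R : realFieldType) (y Z d eps : R) :
  0 < eps <= 1 / 2 -> 0 <= Z <= 1 -> 0 <= d -> 
  y * (1 - eps) <= 1 -> 1 <= y * (1 + eps) ->
  y * (Z + d + eps) - (1 - eps) ^+ 2 * Z * y ^+ 2 <= 2 * d + 8 * eps.
Proof.
move=> /andP[e0 e2] /andP[Z0 Z1] d0 y1 y2.
have y0 : 0 < y by rewrite ltNge; apply/negP => y0; nra.
have y3 : y <= 2 by nra.
have y4 : 1 - eps <= y by nra.
have e3 : 1 - 3 * eps <= (1 - eps) ^+ 2 * y.
  apply: (@le_trans _ _ ((1 - eps) ^+ 2 * (1 - eps))); first nra.
  by rewrite ler_wpM2l ?sqr_ge0.
have -> : y * (Z + d + eps) - (1 - eps) ^+ 2 * Z * y ^+ 2 =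
  y * (d + eps) + (Z * y) * (1 - (1 - eps) ^+ 2 * y) by ring.
have h1 : y * (d + eps) <= 2 * (d + eps) by rewrite ler_wpM2r// addr_ge0// ltW.
have Zy0 : 0 <= Z * y by rewrite mulr_ge0// ltW.
have Zy2 : Z * y <= 2 by nra.
have h2 : (Z * y) * (1 - (1 - eps) ^+ 2 * y) <= (Z * y) * (3 * eps).
  by rewrite ler_wpM2l//; lra.
have h3 : (Z * y) * (3 * eps) <= 2 * (3 * eps) by rewrite ler_wpM2r//; lra.
lra.
Qed.

Lemma modularity_score_regular (R : realType) (V : finType)
    (E S Q : {set {set V}}) (D : nat) (p eps d : R) :
  (forall e, e \in E -> #|e| = 2%N) -> S \subset E ->
  (0 < #|V|)%N -> (0 < D)%N -> (forall v, degree E v = D) ->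
  finset.partition Q [set: V]%SET -> 0 < p -> 0 < eps <= 1 / 2 -> 0 <= d ->
  (\sum_(A in Q) edges_within E A)%:R / #|E|%:R <=
    \sum_(A in Q) (#|A|%:R / #|V|%:R) ^+ 2 + d ->
  (\sum_(A in Q) edges_within S A)%:R <=
    p * (\sum_(A in Q) edges_within E A)%:R + eps * p * #|E|%:R ->
  (forall v, (1 - eps) * (p * D%:R) <= (degree S v)%:R <= (1 + eps) * (p * D%:R)) ->
  modularity_score R S Q <= 2 * d + 8 * eps.
Proof.
move=> E2 SE V0 D0 degE partQ p0 eps01 d0 hE hQ hdeg.
have /andP[e0 e2] := eps01.
have S2 e : e \in S -> #|e| = 2%N by move/(fintype.subsetP SE)/E2.
pose N : R := #|V|%:R; pose Z : R := \sum_(A in Q) (#|A|%:R / N) ^+ 2.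
have N0 : 0 < N by rewrite ltr0n.
have DR0 : 0 < D%:R :> R by rewrite ltr0n.
have cE : #|E|%:R = N * D%:R / 2 :> R.
  have : (2 * #|E| = #|V| * D)%N.
    by rewrite -handshake// (eq_bigr _ (fun v _ => degE v)) sum_nat_const.
  by move/(congr1 (fun k => k%:R : R)); rewrite !natrM -/N; lra.
have E0 : 0 < #|E|%:R :> R by rewrite cE divr_gt0 ?mulr_gt0.
pose b := p * #|E|%:R; have b0 : 0 < b by rewrite mulr_gt0.
have cS : 2 * #|S|%:R = \sum_v (degree S v)%:R :> R.
  by rewrite -natr_sum handshake// natrM.
(* The edge count is half the degree sum, so it inherits the relative error of the degrees. *)
have Slo : (1 - eps) * b <= #|S|%:R.
  have : \sum_(v : V) (1 - eps) * (p * D%:R) <= \sum_v (degree S v)%:R.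
    by apply: ler_sum => v _; have /andP[] := hdeg v.
  by rewrite -cS sumr_const -[leLHS]mulr_natl -/N /b cE; lra.
have Shi : #|S|%:R <= (1 + eps) * b.
  have : \sum_v (degree S v)%:R <= \sum_(v : V) (1 + eps) * (p * D%:R).
    by apply: ler_sum => v _; have /andP[] := hdeg v.
  by rewrite -cS sumr_const -[leRHS]mulr_natl -/N /b cE; lra.
have S0 : 0 < #|S|%:R :> R.
  by apply: lt_le_trans Slo; rewrite mulr_gt0//; lra.
have Z01 : 0 <= Z <= 1.
  by rewrite sum_card_sqr_le// andbT sumr_ge0// => A _; exact: sqr_ge0.
pose y := b / #|S|%:R.
apply: le_trans (@score_arith R y Z d eps eps01 Z01 d0 _ _); last 2 first.
- by rewrite /y mulrAC ler_pdivrMr// mul1r mulrC.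
- by rewrite /y mulrAC ler_pdivlMr// mul1r mulrC.
rewrite /modularity_score; apply: lerB.
  rewrite -mulr_suml -natr_sum /y mulrAC ler_pM2r ?invr_gt0//.
  apply: le_trans hQ _.
  move: hE; rewrite -/N -/Z ler_pdivrMr// /b => hE.
  have := ler_wpM2l (ltW p0) hE; lra.
rewrite /Z mulr_sumr mulr_suml; apply: ler_sum => A _.
have -> : (1 - eps) ^+ 2 * (#|A|%:R / N) ^+ 2 * y ^+ 2 =
    ((1 - eps) * (p * D%:R) * #|A|%:R) ^+ 2 / (4 * #|S|%:R ^+ 2).
  by rewrite /y /b cE; field; rewrite !gt_eqF.
rewrite ler_pM2r ?invr_gt0 ?mulr_gt0 ?exprn_gt0//.
have h : 0 <= (1 - eps) * (p * D%:R) * #|A|%:R.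
  by rewrite !mulr_ge0 ?subr_ge0 ?(ltW p0)//; lra.
rewrite ler_pXn2r// ?nnegrE//.
rewrite natr_sum mulr_natr -sumr_const.
by apply: ler_sum => v _; have /andP[] := hdeg v.
Qed.

(** * The law of a random subgraph *)

Lemma borel_cantelli_geometric (R : realType) (d : measure_display)
    (T : measurableType d) (P : probability T R) (B : nat -> set T) (c : R) (n0 : nat) :
  0 <= c -> (forall n, measurable (B n)) ->
  (forall n, (n0 <= n)%N -> (P (B n) <= (c / (2 ^ n.+1)%:R)%:E)%E) ->
  {ae P, forall w, \forall n \near \oo, ~ B n w}.
Proof.
move=> c0 mB PB.
(* Emptying the events before [n0] makes the geometric bound hold at every index. *)
pose B' n := if (n0 <= n)%N then B n else set0.
have mB' n : measurable (B' n) by rewrite /B'; case: ifP.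
exists (lim_sup_set B'); split.
- apply: bigcap_measurable => [|k _]; first by exists 0%N.
  exact: bigcup_measurable.
- apply: lim_sup_set_cvg0 => //.
  apply: (@le_lt_trans _ _ (\sum_(n <oo) (c / (2 ^ n.+1)%:R)%:E)%E).
    apply: lee_nneseries => n _; first by move=> _; exact: measure_ge0.
    rewrite /B'; case: ifPn => [/PB//|_].
    by rewrite measure0 lee_fin divr_ge0.
  by apply: le_lt_trans (epsilon_trick0 _ c0) _; exact: ltry.
- move=> w /= nw n _; apply: contrapT => wn; apply: nw.
  exists (maxn n0 n) => // k /=; rewrite geq_max => /andP[n0k nk] Bk.
  by apply: wn; exists k => //; rewrite /B' n0k.
Qed.

Section RandomSubgraphLaw.
Variables (R : realType) (d : measure_display) (T : measurableType d).
Variables (P : probability T R) (V : finType) (E : {set {set V}}) (p : R).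
Variable G : T -> {set {set V}}.
Hypothesis hG : random_subgraph P E p G.

(** Real weights of the push-forward of [P], which turn probabilities of graph properties into
    finite sums. *)
Definition subgraph_law (S : {set {set V}}) : R := fine (P [set w | G w = S]).

(** The event is a finite intersection of removal events and complements of such, or is empty if [S]
    is not inside [E]. *)
Lemma measurable_subgraph_eq S : measurable [set w | G w = S].
Proof.
have [GE mrem _ _] := hG.
have [SE|nSE] := boolP (S \subset E); last first.
  rewrite (_ : [set _ | _] = set0)//; apply/seteqP; split => // w /= Gw.
  by move: nSE; rewrite -Gw GE.
rewrite (_ : [set _ | _] = \bigcap_(e in [set` E])
    (if e \in S then ~` removal_event G e else removal_event G e)).
  apply: fin_bigcap_measurable => [|e /= eE]; first exact: finite_finpred.
  by case: ifP => _; [apply: measurableC|]; exact: mrem.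
apply/seteqP; split => w /=.
  move=> Gw e eE; rewrite /removal_event /=.
  by case: ifPn => /= eS; rewrite Gw ?eS//; apply.
move=> H; apply/setP => e; have [eE|neE] := boolP (e \in E).
  have := H e eE; rewrite /removal_event; case: ifPn => [_ /= /negP|_ /= /negbTE//].
  by rewrite negbK.
rewrite (negbTE (contra (fintype.subsetP (GE w) e) neE)).
by rewrite (negbTE (contra (fintype.subsetP SE e) neE)).
Qed.

Lemma subgraph_law_ge0 S : 0 <= subgraph_law S.
Proof. exact: fine_ge0. Qed.

Lemma subgraph_event_bigcup (Z : pred {set {set V}}) :
  [set w | Z (G w)] = \bigcup_(S in [set` enum Z]) [set w | G w = S].
Proof.
apply/seteqP; split => w /=; first by move=> Zw; exists (G w); rewrite //= mem_enum.
by move=> [S /=]; rewrite mem_enum => ZS ->.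
Qed.

Lemma measurable_subgraph_event (Z : pred {set {set V}}) :
  measurable [set w | Z (G w)].
Proof.
rewrite subgraph_event_bigcup; apply: fin_bigcup_measurable => [|S _].
  exact: finite_finset.
exact: measurable_subgraph_eq.
Qed.

Lemma prob_subgraph_event (Z : pred {set {set V}}) :
  P [set w | Z (G w)] = (\sum_(S | Z S) subgraph_law S)%:E.
Proof.
rewrite subgraph_event_bigcup measure_fin_bigcup => [||S S' _ _ [w [/= <- <-]]//|S _].
- rewrite -fsbig_seq ?enum_uniq// big_enum /= -sumEFin.
  apply: eq_big => // S _; rewrite fineK//; exact: fin_num_measure (measurable_subgraph_eq S).
- exact: finite_finset.
- exact: measurable_subgraph_eq.
Qed.

Lemma subgraph_law_independent : independent_retention E p subgraph_law.
Proof.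
split=> [S|B BE]; first exact: subgraph_law_ge0.
have [_ _ prem indep] := hG.
have := prob_subgraph_event (fun S => (B :&: S)%SET == finset.set0).
rewrite (_ : [set _ | _] = \bigcap_(e in [set` B]) removal_event G e).
  rewrite indep// (eq_bigr (fun=> (1 - p)%:E)) => [|e eB]; last first.
    by apply: prem; exact: (fintype.subsetP BE).
  rewrite prodEFin prodr_const => -[] <-//.
apply/seteqP; split => w /=.
  move=> /eqP/setP BG e /= eB; rewrite /removal_event /=.
  by have := BG e; rewrite !inE eB => /= ->.
move=> H; apply/eqP/setP => e; rewrite !inE.
by apply/negP => /andP[eB]; apply/negP/H.
Qed.

End RandomSubgraphLaw.

(** * Typical subgraphs of the Johnson graph *)

Lemma union_weight (R : realType) (I X : finType) (mu : X -> R) (Z : I -> pred X) :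
  (forall S, 0 <= mu S) ->
  \sum_(S | [exists i, Z i S]) mu S <= \sum_i \sum_(S | Z i S) mu S.
Proof.
move=> mu0; under [leRHS]eq_bigr do rewrite big_mkcond.
rewrite exchange_big big_mkcond /=; apply: ler_sum => S _.
have pos i : 0 <= (if Z i S then mu S else 0) by case: ifP.
case: ifPn => [/existsP[i Zi]|_]; last exact: sumr_ge0.
by rewrite (bigD1 i)//= Zi lerDl sumr_ge0.
Qed.

Definition star (V : finType) (E : {set {set V}}) (v : V) : {set {set V}} :=
  [set e in E | v \in e]%SET.

(** Every condition concerns the intersection of [S] with a fixed subset of [E], the form that the
    Chernoff bounds handle. *)
Definition typical (R : realType) (V : finType) (E : {set {set V}}) (D : nat)
    (p eps : R) (S : {set {set V}}) : bool :=
  [forall c : {ffun V -> V}, #|S :&: monochromatic c E|%SET%:R <=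
     p * #|monochromatic c E|%:R + eps * p * #|E|%:R] &&
  [forall v, (1 - eps) * (p * D%:R) <= #|S :&: star E v|%SET%:R <=
     (1 + eps) * (p * D%:R)].

Lemma atypical_weight (R : realType) (V : finType) (E : {set {set V}}) (D : nat)
    (p eps : R) (mu : {set {set V}} -> R) :
  0 <= p <= 1 -> 0 < eps <= 2 -> (forall v, degree E v = D) ->
  independent_retention E p mu ->
  \sum_(S | ~~ typical E D p eps S) mu S <=
    #|V|%:R ^+ #|V| * expR (- (eps ^+ 2 * (p * #|E|%:R) / 8)) +
    2 * #|V|%:R * expR (- (eps ^+ 2 * (p * D%:R) / 8)).
Proof.
move=> p01 eps02 degE hmu.
(* The bad events: too many monochromatic edges for a colouring, too large a degree, too small a
   degree. *)
pose Z (i : {ffun V -> V} + (V + V)) (S : {set {set V}}) : bool :=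
  match i with
  | inl c => p * #|monochromatic c E|%:R + eps * p * #|E|%:R <=
      #|S :&: monochromatic c E|%SET%:R
  | inr (inl v) => p * #|star E v|%:R + eps * p * D%:R <= #|S :&: star E v|%SET%:R
  | inr (inr v) => #|S :&: star E v|%SET%:R <= p * #|star E v|%:R - eps * p * D%:R
  end.
have starD v : #|star E v| = D by rewrite -(degE v).
have starE v : star E v \subset E by apply/fintype.subsetP => e; rewrite inE => /andP[].
have monoE c : monochromatic c E \subset E.
  by apply/fintype.subsetP => e; rewrite inE => /andP[].
apply: (@le_trans _ _ (\sum_(S | [exists i, Z i S]) mu S)).
  rewrite big_mkcond [leRHS]big_mkcond; apply: ler_sum => S _.
  have mu0 := hmu.1 S.
  case: ifPn => [|_]; last by case: ifP.
  rewrite negb_and => /orP[/forallPn[c]|/forallPn[v]].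
    rewrite -ltNge => /ltW cS; rewrite ifT//.
    by apply/existsP; exists (inl c).
  rewrite negb_and -!ltNge => /orP[] /ltW vS; rewrite ifT//; apply/existsP.
    by exists (inr (inr v)); rewrite /= starD; lra.
  by exists (inr (inl v)); rewrite /= starD; lra.
apply: (le_trans (union_weight _ hmu.1)).
rewrite !big_sumType /=; apply: lerD.
  rewrite -natrX -card_ffun mulr_natl -[leRHS]sumr_const; apply: ler_sum => c _.
  by apply: chernoff_upper hmu _ _ => //; rewrite ler_nat subset_leq_card.
rewrite [leRHS](_ : _ = \sum_(v : V) expR (- (eps ^+ 2 * (p * D%:R) / 8)) +
    \sum_(v : V) expR (- (eps ^+ 2 * (p * D%:R) / 8))); last first.
  by rewrite sumr_const; set x := expR _; rewrite -(mulr_natl x); ring.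
apply: lerD.
  by apply: ler_sum => v _; apply: chernoff_upper hmu _ _ => //; rewrite starD.
by apply: ler_sum => v _; apply: chernoff_lower hmu _ _ => //; rewrite starD.
Qed.

Lemma monochromatic_sub (V : finType) (c : {ffun V -> V}) (E S : {set {set V}}) :
  S \subset E -> monochromatic c S = (S :&: monochromatic c E)%SET.
Proof.
move=> SE; apply/setP => e; rewrite !inE.
by have [/(fintype.subsetP SE) ->|//] := boolP (e \in S).
Qed.

Lemma typical_modularity (R : realType) s (p : R)
    (S : {set {set johnson_vertex (4 * s) (2 * s)}}) :
  (2 <= s)%N -> 0 < p -> S \subset johnson_graph (4 * s) (2 * s) s ->
  typical (johnson_graph (4 * s) (2 * s) s) ('C(2 * s, s) * 'C(2 * s, s)) p
    (s%:R^-1) S ->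
  0 <= modularity R S <= 2 * (2 / Num.sqrt (Num.sqrt s%:R)) + 8 * s%:R^-1.
Proof.
move=> s2 p0 SE /andP[/forallP Sc /forallP Sv].
have V0 : (0 < #|johnson_vertex (4 * s) (2 * s)|)%N.
  by rewrite card_johnson_vertex bin_gt0; lia.
apply/andP; split.
  by apply: modularity_ge0 => // e /(fintype.subsetP SE)/johnson_edge_card.
apply: modularity_le => Q partQ.
apply: (modularity_score_regular (E := johnson_graph (4 * s) (2 * s) s)
  (D := ('C(2 * s, s) * 'C(2 * s, s))%N) (p := p)) => //.
- exact: johnson_edge_card.
- by rewrite muln_gt0 bin_gt0; lia.
- move=> v; rewrite johnson_degree; last by lia.
  by congr (_ * 'C(_, _))%N; lia.
- rewrite invr_gt0 ltr0n div1r lef_pV2 ?posrE ?ltr0n ?ler_nat ?s2 ?andbT//; lia.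
- exact: johnson_partition_bound.
- have [c cE] := partition_colouring partQ.
  have E0 e : e \in johnson_graph (4 * s) (2 * s) s -> e != finset.set0.
    by move/johnson_edge_card => e2; rewrite -card_gt0 e2.
  rewrite !cE//; last by move=> e /(fintype.subsetP SE)/E0.
  by rewrite (monochromatic_sub c SE).
- move=> v; have := Sv v.
  rewrite (_ : #|_| = degree S v)//; apply: eq_card => e; rewrite !inE.
  by have [/(fintype.subsetP SE) ->|//] := boolP (e \in S).
Qed.

(** The inequality fails at 11, whence the threshold. The factor 320 is chosen to yield p D >= 80
    s^3 below. *)
Lemma four_pow_ge s : (12 <= s)%N -> (320 * s ^ 4 <= 4 ^ s)%N.
Proof.
move=> s12; rewrite -(subnK s12); elim: (s - 12)%N => [|n IH]; first by rewrite add0n; lia.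
rewrite addSn (expnS 4 (n + 12)) (leq_trans _ (leq_mul (leqnn 4) IH))//.
nia.
Qed.

Lemma expR_ge_two_pow (R : realType) n : 2 ^+ n <= expR n%:R :> R.
Proof.
rewrite -[n%:R]mulr1 expRM_natl lerXn2r ?nnegrE ?expR_ge0//.
by have := @expR_ge1Dx R 1.
Qed.

(** With L = p D / (16 s^2) the two terms are (N e^(-L))^N and 2 N e^(-2L). As N <= e^(4s) and L >=
    5s, they total at most 3 e^(-s) <= 6 / 2^(s+1). *)
Lemma atypical_weight_johnson (R : realType) s (p : R)
    (mu : {set {set johnson_vertex (4 * s) (2 * s)}} -> R) :
  (12 <= s)%N -> p <= 1 -> Num.sqrt s%:R / 2 ^+ (2 * s) <= p ->
  independent_retention (johnson_graph (4 * s) (2 * s) s) p mu ->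
  \sum_(S | ~~ typical (johnson_graph (4 * s) (2 * s) s)
     ('C(2 * s, s) * 'C(2 * s, s)) p (s%:R^-1) S) mu S <= 6 / (2 ^ s.+1)%:R.
Proof.
set V := johnson_vertex _ _; set E := johnson_graph _ _ _ => s12 p1 plow hmu.
pose Dn := ('C(2 * s, s) * 'C(2 * s, s))%N; rewrite -/Dn.
have degE (v : V) : degree E v = Dn.
  rewrite johnson_degree; last by lia.
  by rewrite /Dn; congr (_ * 'C(_, _))%N; lia.
have cardE : (2 * #|E| = #|V| * Dn)%N.
  rewrite card_johnson_graph; last by lia.
  by rewrite card_johnson_vertex /Dn; congr (_ * (_ * 'C(_, _)))%N; lia.
have N16 : (#|V| <= 2 ^ (4 * s))%N.
  rewrite card_johnson_vertex -leq_sqr.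
  have := central_bin_upper s.*2.
  have -> : (s.*2.*2 = 4 * s)%N by lia.
  have -> : (s.*2 = 2 * s)%N by lia.
  have -> : ((2 ^ (4 * s)) ^ 2 = 16 ^ (2 * s))%N.
    by rewrite -expnM (_ : 16 = 2 ^ 4)%N// -expnM; congr (_ ^ _)%N; lia.
  by apply: leq_trans; rewrite leq_pmulr.
have D16 : (16 ^ s <= Dn * (4 * s))%N.
  have := central_bin_lower s; rewrite (_ : s.*2 = 2 * s)%N ?[s == 0%N]gtn_eqF ?orbF//; lia.
have V0 : (0 < #|V|)%N by rewrite card_johnson_vertex bin_gt0; lia.
have h4 := four_pow_ge s12.
have s0 : 0 < s%:R :> R by rewrite ltr0n; lia.
have p0 : 0 <= p by apply: le_trans plow; rewrite divr_ge0 ?sqrtr_ge0 ?exprn_ge0.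
have eps02 : 0 < (s%:R : R)^-1 <= 2.
  apply/andP; split; first by rewrite invr_gt0.
  by apply: (@le_trans _ _ 1); [rewrite invf_le1// ler1n; lia|lra].
have p01 : 0 <= p <= 1 by rewrite p0.
apply: (le_trans (atypical_weight p01 eps02 degE hmu)).
clearbody Dn.
pose N : R := #|V|%:R; pose D : R := Dn%:R; rewrite -/N -/D.
have cER : #|E|%:R = N * D / 2 :> R.
  by rewrite /N /D -natrM -cardE natrM mulrC mulKf// pnatr_eq0.
pose L := s%:R^-1 ^+ 2 * (p * D) / 16.
(* From p >= 4^(-s) and D >= 16^s / (4s) follows p D >= 4^s / (4s). *)
have pD : 80 * s%:R ^+ 3 <= p * D.
  have p4 : 1 / 4 ^+ s <= p.
    apply: le_trans plow; rewrite exprM (_ : 2 ^+ 2 = 4); last by ring.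
    rewrite ler_pM2r ?invr_gt0 ?exprn_gt0//.
    by rewrite -[leLHS]sqrtr1 ler_sqrt ?ler0n // ler1n; lia.
  have D4 : 4 ^+ s * 4 ^+ s <= D * (4 * s%:R) :> R.
    rewrite -exprMn (_ : 4 * 4 = 16%:R); last by ring.
    by rewrite -natrX /D -!natrM ler_nat.
  have h4R : 320 * s%:R ^+ 4 <= 4 ^+ s :> R.
    by rewrite -!natrX -natrM ler_nat.
  have q0 : 0 < 4 ^+ s :> R by rewrite exprn_gt0.
  rewrite -(ler_pM2r (_ : 0 < 4 * s%:R)) ?mulr_gt0//.
  apply: (@le_trans _ _ (4 ^+ s)); first by move: h4R; lra.
  apply: (@le_trans _ _ ((1 / 4 ^+ s) * (4 ^+ s * 4 ^+ s))).
    by rewrite mulrA div1r mulVf ?mul1r ?gt_eqF.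
  by rewrite -[leRHS]mulrA; apply: ler_pM => //; rewrite ?divr_ge0 ?mulr_ge0 ?(ltW q0).
have L5 : 5 * s%:R <= L.
  have -> : L = p * D / (16 * s%:R ^+ 2) by rewrite /L; field; rewrite gt_eqF.
  by rewrite ler_pdivlMr ?mulr_gt0 ?exprn_gt0//; move: pD; lra.
have -> : s%:R^-1 ^+ 2 * (p * #|E|%:R) / 8 = L * N by rewrite cER /L; field; rewrite gt_eqF.
have -> : s%:R^-1 ^+ 2 * (p * D) / 8 = 2 * L by rewrite /L; field; rewrite gt_eqF.
have Ne : N <= expR (4 * s%:R).
  apply: (@le_trans _ _ (2 ^+ (4 * s))); first by rewrite -natrX ler_nat.
  by rewrite -natrM; exact: expR_ge_two_pow.
have N0 : 0 <= N by rewrite ler0n.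
have NL : N * expR (- L) <= expR (- s%:R).
  apply: (@le_trans _ _ (expR (4 * s%:R) * expR (- L))).
    by rewrite ler_wpM2r ?expR_ge0.
  by rewrite -expRD ler_expR; lra.
have t2 : 2 * N * expR (- (2 * L)) <= 2 * expR (- s%:R).
  rewrite -mulrA ler_pM2l//; apply: le_trans NL.
  by apply: (ler_wpM2l N0); rewrite ler_expR; lra.
have t3 : expR (- s%:R) <= (2 ^+ s)^-1 :> R.
  by rewrite expRN lef_pV2 ?posrE ?expR_gt0 ?exprn_gt0//; exact: expR_ge_two_pow.
have t1 : N ^+ #|V| * expR (- (L * N)) <= expR (- s%:R).
  have -> : expR (- (L * N)) = expR (- L) ^+ #|V|.
    by rewrite -expRM_natl; congr expR; rewrite /N; ring.
  rewrite -exprMn; apply: (@le_trans _ _ (expR (- s%:R) ^+ #|V|)).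
    by rewrite lerXn2r ?nnegrE ?mulr_ge0 ?expR_ge0.
  by rewrite -[#|V|]prednK// exprS ler_piMr ?expR_ge0// exprn_ile1 ?expR_ge0//.
apply: le_trans (lerD t1 t2) _; clear t1.
have -> : 6 / (2 ^ s.+1)%:R = 3 * (2 ^+ s)^-1 :> R.
  by rewrite natrX exprS; field; rewrite gt_eqF// exprn_gt0.
lra.
Qed.

(** * Almost sure convergence *)

Theorem theorem3p10 (R : realType) (p : nat -> R)
    (hp01 : forall s : nat, 0 <= p s <= 1)
    (hp : little_omega p (fun s => Num.sqrt s%:R / 2 ^+ (2 * s)))
    (d : measure_display) (T : measurableType d) (P : probability T R)
    (G : forall s : nat, T -> {set {set johnson_vertex (4 * s) (2 * s)}})
    (hG : forall s : nat,
       random_subgraph P (johnson_graph (4 * s) (2 * s) s) (p s) (G s)) :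
  {ae P, forall w, (fun s => modularity R (G s w)) @ \oo --> (0 : R)}.
Proof.
(* Divergence of the ratio yields the lower bound on [p s] from some index on. *)
have [n1 _ hn1] : \forall s \near \oo, 1 <= p s / (Num.sqrt s%:R / 2 ^+ (2 * s)).
  by have /cvgryPge := hp; exact.
have plow s : (maxn 12 n1 <= s)%N -> Num.sqrt s%:R / 2 ^+ (2 * s) <= p s.
  rewrite geq_max => /andP[s12 /hn1 /=].
  rewrite ler_pdivlMr ?mul1r// divr_gt0 ?exprn_gt0// sqrtr_gt0 ltr0n; lia.
pose good s := typical (johnson_graph (4 * s) (2 * s) s)
  ('C(2 * s, s) * 'C(2 * s, s)) (p s) (s%:R^-1).
have : {ae P, forall w, \forall s \near \oo, ~ ~~ good s (G s w)}.
  apply: (@borel_cantelli_geometric _ _ _ P (fun s => [set w | ~~ good s (G s w)])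
    6 (maxn 12 n1)) => // [s|s s0].
    exact: (measurable_subgraph_event (hG s) (fun S => ~~ good s S)).
  rewrite (prob_subgraph_event (hG s) (fun S => ~~ good s S)) lee_fin.
  have /andP[_ p1] := hp01 s; apply: atypical_weight_johnson => //.
  - by move: s0; rewrite geq_max => /andP[].
  - exact: plow.
  - exact: subgraph_law_independent.
apply: filterS => w goodw; apply/cvgrPdist_le => e e0.
near=> s.
have s0 : (maxn 12 n1 <= s)%N by near: s; exact: nbhs_infty_ge.
have s12 : (12 <= s)%N by move: s0; rewrite geq_max => /andP[].
have sR : 1 <= s%:R :> R by rewrite ler1n; lia.
have p0 : 0 < p s.
  apply: lt_le_trans (plow s s0); rewrite divr_gt0 ?exprn_gt0// sqrtr_gt0.
  by rewrite (lt_le_trans _ sR).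
have [GE _ _ _] := hG s.
have goods : good s (G s w) by apply/negPn/negP; near: s.
have s2 : (2 <= s)%N by lia.
have /andP[m0 m1] := typical_modularity s2 p0 (GE w) goods.
rewrite sub0r normrN ger0_norm//; apply: le_trans m1 _.
(* With r = s^(1/4) >= 1, the bound 4 / r + 8 / s is at most 12 / r, which is at most [e] once r >=
   12 / e. *)
set r := Num.sqrt (Num.sqrt s%:R).
have r4 : r ^+ 4 = s%:R.
  by rewrite (exprM _ 2 2) sqr_sqrtr ?sqrtr_ge0// sqr_sqrtr.
have r1 : 1 <= r.
  by rewrite -[leLHS](@sqrtr1 R) ler_wsqrtr// -[leLHS](@sqrtr1 R) ler_wsqrtr.
have rinv : s%:R^-1 <= r^-1.
  rewrite lef_pV2 ?posrE ?(lt_le_trans ltr01)// -r4 exprS ler_peMr//.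
    by rewrite (le_trans ler01).
  exact: exprn_ege1.
have re : 12 / e <= r.
  rewrite -(@ler_pXn2r _ 4) ?nnegrE ?(le_trans ler01 r1) ?divr_ge0 ?(ltW e0)// r4.
  by near: s; exact: nbhs_infty_ger.
have r0 : 0 < r by exact: lt_le_trans r1.
have re' : 12 * r^-1 <= e.
  by rewrite ler_pdivrMr// mulrC -ler_pdivrMr.
have : 2 * (2 / r) + 8 * s%:R^-1 <= 12 * r^-1 by lra.
by move/le_trans; apply.
Unshelve. all: by end_near. Qed.
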